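(* Let $(H,R,\alpha)$ be a triangular Hom-Hopf algebra and $(B,\langle|\rangle,\beta)$ a cotriangular Hom-Hopf algebra. Then the category ${}^{B}_{H}\mathbb{L}$ of left-left $(H,B)$-Hom-Long dimodules, with braiding $$C_{M,N}:M\otimes N\to N\otimes M,\qquad m\otimes n\mapsto\langle m_{(-1)}|n_{(-1)}\rangle\, R^{(2)}\cdot\nu^{-2}(n_{(0)})\otimes R^{(1)}\cdot\mu^{-2}(m_{(0)})$$ for $m\in(M,\mu)$, $n\in(N,\nu)$, is symmetric.
   Context: All vector spaces, maps and tensor products are over a fixed field $k$; Sweedler notation $\Delta(c)=c_1\otimes c_2$ is used, and $\rho(m)=m_{(-1)}\otimes m_{(0)}$ for coactions. A Hom-algebra $(A,\mu_A,1_A,\alpha)$: a linear space $A$ with a linear multiplication, $1_A\in A$ and a linear bijection $\alpha:A\to A$ with $\alpha(aa')=\alpha(a)\alpha(a')$, $\alpha(1_A)=1_A$, $\alpha(a)(a'a'')=(aa')\alpha(a'')$, $a1_A=1_Aa=\alpha(a)$. A left $(A,\alpha)$-Hom-module $(M,\cdot,\mu)$: a linear space $M$, linear $\cdot:A\otimes M\to M$, and a linear bijection $\mu:M\to M$ with $\mu(a\cdot m)=\alpha(a)\cdot\mu(m)$, $\alpha(a)\cdot(a'\cdot m)=(aa')\cdot\mu(m)$, $1_A\cdot m=\mu(m)$. Morphisms are linear maps $f$ with $f(a\cdot m)=a\cdot f(m)$ commuting with the structure maps. A Hom-coalgebra $(C,\Delta,\epsilon,\beta)$: linear $\Delta:C\to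 C\otimes C$, $\epsilon:C\to k$, and a linear bijection $\beta$ with $\Delta(\beta(c))=\beta(c_1)\otimes\beta(c_2)$, $\epsilon\circ\beta=\epsilon$, $\beta(c_1)\otimes c_{21}\otimes c_{22}=c_{11}\otimes c_{12}\otimes\beta(c_2)$, $\epsilon(c_1)c_2=c_1\epsilon(c_2)=\beta(c)$. A left $(C,\beta)$-Hom-comodule $(M,\rho,\mu)$: linear $\rho:M\to C\otimes M$ and a linear bijection $\mu$ with $\rho(\mu(m))=\beta(m_{(-1)})\otimes\mu(m_{(0)})$, $\epsilon(m_{(-1)})m_{(0)}=\mu(m)$, $\beta(m_{(-1)})\otimes m_{(0)(-1)}\otimes m_{(0)(0)}=m_{(-1)1}\otimes m_{(-1)2}\otimes\mu(m_{(0)})$. Morphisms are colinear maps commuting with the structure maps. A Hom-bialgebra $(H,\alpha)$: a Hom-algebra and Hom-coalgebra with the same structure map $\alpha$ such that $\Delta(hh')=\Delta(h)\Delta(h')$, $\Delta(1)=1\otimes1$, $\epsilon(hh')=\epsilon(h)\epsilon(h')$, $\epsilon(1)=1$. It is a Hom-Hopf algebra if there is a linear map $S:H\to H$ (antipode) with $S(h_1)h_2=h_1S(h_2)=\epsilon(h)1_H$ and $S\circ\alpha=\alpha\circ S$. A quasitriangular Hom-Hopf algebra $(H,R,\alpha)$: a Hom-Hopf algebra $(H,\alpha)$ with $R=R^{(1)}\otimes R^{(2)}\in H\otimes H$ (summation understood, $r=r^{(1)}\otimes r^{(2)}$ a second copy of $R$) such that $\epsilon(R^{(1)})R^{(2)}=R^{(1)}\epsilon(R^{(2)})=1_H$;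 $\Delta(R^{(1)})\otimes\alpha(R^{(2)})=\alpha(R^{(1)})\otimes\alpha(r^{(1)})\otimes R^{(2)}r^{(2)}$; $\alpha(R^{(1)})\otimes\Delta(R^{(2)})=R^{(1)}r^{(1)}\otimes\alpha(r^{(2)})\otimes\alpha(R^{(2)})$; $\Delta^{cop}(h)R=R\Delta(h)$ with $\Delta^{cop}(h)=h_2\otimes h_1$; $\alpha(R^{(1)})\otimes\alpha(R^{(2)})=R^{(1)}\otimes R^{(2)}$. It is triangular if $R^{-1}=R^{(2)}\otimes R^{(1)}$. A coquasitriangular Hom-Hopf algebra $(B,\langle|\rangle,\beta)$: a Hom-Hopf algebra $(B,\beta)$ with a bilinear form $\langle|\rangle:B\otimes B\to k$ such that for all $h,g,l\in B$: $\langle hg|\beta(l)\rangle=\langle\beta(h)|l_2\rangle\langle\beta(g)|l_1\rangle$; $\langle\beta(h)|gl\rangle=\langle h_1|\beta(g)\rangle\langle h_2|\beta(l)\rangle$; $\langle h_1|g_1\rangle g_2h_2=h_1g_1\langle h_2|g_2\rangle$; $\langle1|h\rangle=\langle h|1\rangle=\epsilon(h)$; $\langle\beta(h)|\beta(g)\rangle=\langle h|g\rangle$. It is cotriangular if $\langle h_1|g_1\rangle\langle g_2|h_2\rangle=\epsilon(h)\epsilon(g)$ for all $h,g\in B$. A left-left $(H,B)$-Hom-Long dimodule $(M,\cdot,\rho,\mu)$: $(M,\cdot,\mu)$ is a left $(H,\alpha)$-Hom-module and $(M,\rho,\mu)$ is a left $(B,\beta)$-Hom-comodule with $\rho(h\cdot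 m)=\beta(m_{(-1)})\otimes\alpha(h)\cdot m_{(0)}$. The category ${}^{B}_{H}\mathbb{L}$ has these as objects and, as morphisms, the $H$-linear $B$-colinear maps commuting with structure maps. Monoidal structure on ${}^{B}_{H}\mathbb{L}$: for $(M,\mu),(N,\nu)$, the tensor product is $(M\otimes N,\mu\otimes\nu)$ with $h\cdot(m\otimes n)=h_1\cdot m\otimes h_2\cdot n$ and $\rho(m\otimes n)=\beta^{-2}(m_{(-1)}n_{(-1)})\otimes m_{(0)}\otimes n_{(0)}$; the unit is $I=(k,\mathrm{id})$ with $h\cdot 1=\epsilon(h)$, $\rho(1)=1_B\otimes1$; for $(U,\mu),(V,\nu),(W,\omega)$ the associator is $a_{U,V,W}((u\otimes v)\otimes w)=\mu^{-1}(u)\otimes(v\otimes\omega(w))$, and the unit constraints are $l_V(\lambda\otimes v)=\lambda\nu^{-1}(v)$, $r_V(v\otimes\lambda)=\lambda\nu^{-1}(v)$ for $\lambda\in k$. A braiding $C$ on a monoidal category is a symmetry if $C_{Y,X}\circ C_{X,Y}=id_{X\otimes Y}$ for all $X,Y$; the category is then called symmetric. *)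

(* Defs.v *)
From HB Require Import structures.
From mathcomp Require Import all_boot all_order all_algebra.
From mathcomp Require Import boolp.

Set Implicit Arguments.
Unset Strict Implicit.
Unset Printing Implicit Defensive.

Import GRing.Theory.

Local Open Scope ring_scope.
Local Open Scope quotient_scope.

Reserved Notation "u ⊗ v" (at level 40, left associativity).
Reserved Notation "\sw_ ( a , b <- t ) E"
  (at level 41, a name, b name, t at level 100, E at level 41,
   format "'[' \sw_ ( a ,  b  <-  t ) '/  '  E ']'").


Local Notation linear f := (GRing.linear_for *:%R f).
Local Notation bilinear f := (bilinear_for *:%R *:%R f).

(* A tensor is a formal sum of pairs; two formal sums are identified when      *)
(* every bilinear map, into any vector space, takes the same value on both.    *)
Section Tensor.
Variables (k : fieldType) (U V : lmodType k).

Definition tensor_eqv (s t : seq (U * V)) : Prop :=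
  forall (W : lmodType k) (f : {bilinear U -> V -> W}),
    \sum_(p <- s) f p.1 p.2 = \sum_(p <- t) f p.1 p.2.

Definition tensor_rel (s t : seq (U * V)) : bool := `[< tensor_eqv s t >].

Lemma tensor_rel_refl : reflexive tensor_rel.
Proof. by move=> s; apply/asboolP. Qed.
Lemma tensor_rel_sym : symmetric tensor_rel.
Proof. by move=> s t; apply/asboolP/asboolP => e W f; rewrite e. Qed.
Lemma tensor_rel_trans : transitive tensor_rel.
Proof.
by move=> t s r /asboolP e1 /asboolP e2; apply/asboolP => W f; rewrite e1 e2.
Qed.

Canonical tensor_equiv :=
  EquivRel tensor_rel tensor_rel_refl tensor_rel_sym tensor_rel_trans.

Definition tensor := {eq_quot tensor_equiv}.

HB.instance Definition _ := Choice.on tensor.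
HB.instance Definition _ := Quotient.on tensor.

(* Sweedler's notation: f is evaluated on some expression of t as a sum of     *)
(* pure tensors. The result does not depend on that expression when f is       *)
(* bilinear (lemmas sw_pure and sw_linear).                                    *)
Definition sweedler (W : lmodType k) (t : tensor) (f : U -> V -> W) : W :=
  \sum_(p <- repr t) f p.1 p.2.

Definition tensor_zero : tensor := \pi_tensor [::].
Definition tensor_add (s t : tensor) : tensor := \pi_tensor (repr s ++ repr t).
Definition tensor_scale (a : k) (t : tensor) : tensor :=
  \pi_tensor [seq (a *: p.1, p.2) | p <- repr t].
Definition tensor_opp (t : tensor) : tensor := tensor_scale (-1) t.
Definition ptensor (u : U) (v : V) : tensor := \pi_tensor [:: (u, v)].

Lemma tensor_inj (s t : tensor) :
  (forall (W : lmodType k) (f : {bilinear U -> V -> W}),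
     sweedler s f = sweedler t f) -> s = t.
Proof.
move=> e; rewrite -[s]reprK -[t]reprK; apply/eqmodP/asboolP => W f; exact: e.
Qed.

Section Bil.
Variables (W : lmodType k) (f : {bilinear U -> V -> W}).

Lemma sweedler_pi s : sweedler (\pi_tensor s) f = \sum_(p <- s) f p.1 p.2.
Proof.
have /eqmodP/asboolP e : repr (\pi_tensor s) = s %[mod tensor].
  by rewrite reprK.
exact: e.
Qed.

Lemma sweedlerp0 : sweedler tensor_zero f = 0.
Proof. by rewrite sweedler_pi big_nil. Qed.
Lemma sweedlerpD s t :
  sweedler (tensor_add s t) f = sweedler s f + sweedler t f.
Proof. by rewrite sweedler_pi big_cat. Qed.
Lemma sweedlerpZ a t : sweedler (tensor_scale a t) f = a *: sweedler t f.
Proof.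
rewrite sweedler_pi big_map scaler_sumr.
by apply: eq_bigr => p _ /=; rewrite linearZl_LR.
Qed.
Lemma sweedlerpN t : sweedler (tensor_opp t) f = - sweedler t f.
Proof. by rewrite sweedlerpZ scaleN1r. Qed.
Lemma sweedlerpp u v : sweedler (ptensor u v) f = f u v.
Proof. by rewrite sweedler_pi big_seq1. Qed.
End Bil.

Definition sweedlerp := (sweedlerp0, sweedlerpD, sweedlerpZ, sweedlerpN, sweedlerpp).

Lemma tensor_addA : associative tensor_add.
Proof. by move=> r s t; apply: tensor_inj => W f; rewrite !sweedlerp addrA. Qed.
Lemma tensor_addC : commutative tensor_add.
Proof. by move=> s t; apply: tensor_inj => W f; rewrite !sweedlerp addrC. Qed.
Lemma tensor_add0 : left_id tensor_zero tensor_add.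
Proof. by move=> s; apply: tensor_inj => W f; rewrite !sweedlerp add0r. Qed.
Lemma tensor_addN : left_inverse tensor_zero tensor_opp tensor_add.
Proof. by move=> s; apply: tensor_inj => W f; rewrite !sweedlerp addNr. Qed.

HB.instance Definition _ := GRing.isZmodule.Build tensor
  tensor_addA tensor_addC tensor_add0 tensor_addN.

Lemma tensor_scaleA a b t :
  tensor_scale a (tensor_scale b t) = tensor_scale (a * b) t.
Proof. by apply: tensor_inj => W f; rewrite !sweedlerp scalerA. Qed.
Lemma tensor_scale1 : left_id 1 tensor_scale.
Proof. by move=> t; apply: tensor_inj => W f; rewrite !sweedlerp scale1r. Qed.
Lemma tensor_scaleDr : right_distributive tensor_scale +%R.
Proof. by move=> a s t; apply: tensor_inj => W f; rewrite !sweedlerp scalerDr. Qed.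
Lemma tensor_scaleDl t : {morph tensor_scale^~ t : a b / a + b}.
Proof. by move=> a b; apply: tensor_inj => W f; rewrite !sweedlerp scalerDl. Qed.

HB.instance Definition _ := GRing.Zmodule_isLmodule.Build k tensor
  tensor_scaleA tensor_scale1 tensor_scaleDr tensor_scaleDl.

Lemma ptensor_bilinear : bilinear ptensor.
Proof.
split=> [v|u] a x y; apply: tensor_inj => W f;
  rewrite (sweedlerpD f (tensor_scale a _)) !sweedlerp.
- by rewrite linearPl.
- by rewrite linearPr.
Qed.

HB.instance Definition _ :=
  bilinear_isBilinear.Build k U V tensor *:%R *:%R ptensor ptensor_bilinear.

Lemma tensor_reprE (t : tensor) : t = sweedler t ptensor.
Proof.
apply: tensor_inj => W f.
have h (s : seq (U * V)) :
    sweedler (\sum_(p <- s) ptensor p.1 p.2 : tensor) f = \sum_(p <- s) f p.1 p.2.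
  elim: s => [|p s IH]; first by rewrite !big_nil (sweedlerp0 f).
  by rewrite !big_cons (sweedlerpD f (ptensor _ _)) sweedlerpp IH.
by rewrite /(sweedler t ptensor) h.
Qed.

End Tensor.

Arguments tensor {k} (U V)%_type.
Notation "U ⊗ V" := (tensor U V) : type_scope.
Notation "u ⊗ v" := (ptensor u v) : ring_scope.
Notation "\sw_ ( a , b <- t ) E" := (sweedler t (fun a b => E)) : ring_scope.

Section TensorTheory.
Variable k : fieldType.
Implicit Types U V W X : lmodType k.

Lemma sw_pure U V W (f : U -> V -> W) (u : U) (v : V) :
  bilinear f -> sweedler (u ⊗ v) f = f u v.
Proof.
move=> bf; pose m := bilinear_isBilinear.Build k U V W *:%R *:%R f bf.
pose g : {bilinear U -> V -> W} := HB.pack f m.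
exact: (sweedlerpp g).
Qed.

Lemma sw_linear U V W (f : U -> V -> W) :
  bilinear f -> linear (fun t : U ⊗ V => sweedler t f).
Proof.
move=> bf; pose m := bilinear_isBilinear.Build k U V W *:%R *:%R f bf.
pose g : {bilinear U -> V -> W} := HB.pack f m.
by move=> a s t; rewrite (sweedlerpD g (tensor_scale a s)) (sweedlerpZ g).
Qed.

Lemma linear_sumE U V (f : U -> V) I (r : seq I) (E : I -> U) :
  linear f -> f (\sum_(i <- r) E i) = \sum_(i <- r) f (E i).
Proof.
move=> lf; pose m := GRing.isLinear.Build k U V *:%R f lf.
pose g : {linear U -> V} := HB.pack f m.
exact: (linear_sum g).
Qed.

Lemma linear_sw U V W X (g : W -> X) (t : U ⊗ V) (f : U -> V -> W) :
  linear g -> g (sweedler t f) = sweedler t (fun u v => g (f u v)).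
Proof. exact: linear_sumE. Qed.

Lemma tensor_ext U V W (f g : U ⊗ V -> W) : linear f -> linear g ->
  (forall u v, f (u ⊗ v) = g (u ⊗ v)) -> f =1 g.
Proof.
move=> lf lg e t; rewrite [t]tensor_reprE !linear_sw //.
by apply: eq_bigr => p _; apply: e.
Qed.

Lemma eq_sw U V W (t : U ⊗ V) (f g : U -> V -> W) :
  (forall u v, f u v = g u v) -> sweedler t f = sweedler t g.
Proof. by move=> e; apply: eq_bigr => p _; apply: e. Qed.

Lemma exchange_sw U V U' V' W (s : U ⊗ V) (t : U' ⊗ V')
    (f : U -> V -> U' -> V' -> W) :
  \sw_(a, b <- s) \sw_(c, d <- t) f a b c d =
  \sw_(c, d <- t) \sw_(a, b <- s) f a b c d.
Proof. exact: exchange_big. Qed.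

Lemma lin_id U : linear (fun x : U => x). Proof. by []. Qed.

Lemma lin_comp U V W (g : {linear V -> W}) (f : U -> V) :
  linear f -> linear (fun x => g (f x)).
Proof. by move=> lf a x y; rewrite lf linearP. Qed.

Lemma lin_bl U V V' W (b : {bilinear V -> V' -> W}) (f : U -> V) w :
  linear f -> linear (fun x => b (f x) w).
Proof. by move=> lf a x y; rewrite lf linearPl. Qed.

Lemma lin_br U V V' W (b : {bilinear V -> V' -> W}) (f : U -> V') w :
  linear f -> linear (fun x => b w (f x)).
Proof. by move=> lf a x y; rewrite lf linearPr. Qed.

Lemma lin_scalar U V (e : {scalar V}) (f : U -> V) :
  linear f -> linear (fun x => e (f x) : k^o).
Proof. by move=> lf a x y; rewrite lf linearP. Qed.

Lemma lin_bsl U V (b : {biscalar V}) (f : U -> V) w :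
  linear f -> linear (fun x => b (f x) w : k^o).
Proof. by move=> lf a x y; rewrite lf linearPl. Qed.

Lemma lin_bsr U V (b : {biscalar V}) (f : U -> V) w :
  linear f -> linear (fun x => b w (f x) : k^o).
Proof. by move=> lf a x y; rewrite lf linearPr. Qed.

Lemma lin_scl U V (f : U -> k^o) (v : V) :
  linear f -> linear (fun x => (f x : k) *: v).
Proof. by move=> lf a x y; rewrite lf scalerDl scalerA. Qed.

Lemma lin_scr U V (f : U -> V) (c : k) :
  linear f -> linear (fun x => c *: f x).
Proof. by move=> lf a x y; rewrite lf scalerDr !scalerA mulrC. Qed.

Lemma lin_ml U (f : U -> k^o) (c : k) :
  linear f -> linear (fun x => (f x : k) * c : k^o).
Proof. by move=> lf a x y; rewrite lf mulrDl -mulrA. Qed.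

Lemma lin_mr U (f : U -> k^o) (c : k) :
  linear f -> linear (fun x => c * (f x : k) : k^o).
Proof. by move=> lf a x y; rewrite lf mulrDr mulrCA. Qed.

Lemma lin_swt U V V' W (t : U -> V ⊗ V') (f : V -> V' -> W) :
  linear t -> bilinear f -> linear (fun x => sweedler (t x) f).
Proof. by move=> lt bf a x y; rewrite lt sw_linear. Qed.

Lemma lin_swb U V V' W (t : V ⊗ V') (f : U -> V -> V' -> W) :
  (forall u v, linear (fun x => f x u v)) -> linear (fun x => sweedler t (f x)).
Proof.
move=> lf a x y; rewrite /sweedler scaler_sumr -big_split.
by apply: eq_bigr => p _; rewrite lf.
Qed.

End TensorTheory.

(* Proves that a Sweedler-style expression is linear, or bilinear. *)
Ltac mlin := cbn beta;
  lazymatch goal with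
  | |- GRing.linear_for _ (fun x => x) => exact: lin_id
  | |- GRing.linear_for _ (fun x => sweedler (@?t x) (@?f x)) =>
      first [ apply: lin_swb => ? ?; mlin
            | apply: (@lin_swt _ _ _ _ _ t _); [mlin | split => ?; mlin]]
  | |- GRing.linear_for _ (fun x => @ptensor ?k ?A ?B (@?g x) (@?f x)) =>
      first [apply: (@lin_br k _ _ _ _ (@ptensor k A B) f)
            |apply: (@lin_bl k _ _ _ _ (@ptensor k A B) g)]; mlin
  | |- GRing.linear_for _ (fun x => Bilinear.sort ?b (@?g x) (@?f x)) =>
      first [apply: (@lin_br _ _ _ _ _ b f) | apply: (@lin_bsr _ _ _ b f)
            |apply: (@lin_bl _ _ _ _ _ b g) | apply: (@lin_bsl _ _ _ b g)]; mlin
  | |- GRing.linear_for _ (fun x => (@?g x) *: (@?f x)) =>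
      first [apply: (@lin_scr _ _ _ f _) | apply: (@lin_scl _ _ _ g _)]; mlin
  | |- GRing.linear_for _ (fun x => (@?g x) * (@?f x)) =>
      first [apply: (@lin_mr _ _ f _) | apply: (@lin_ml _ _ g _)]; mlin
  | |- GRing.linear_for _ (fun x => GRing.Linear.sort ?g (@?f x)) =>
      first [apply: (@lin_comp _ _ _ _ g f) | apply: (@lin_scalar _ _ _ g f)]; mlin
  | |- GRing.linear_for _ (fun x => ?g (@?f x)) =>
      apply: (@lin_comp _ _ _ _ g f); mlin
  | |- GRing.linear_for _ _ => move=> ? ? ?; exact: linearP
  | |- bilinear_for _ _ _ => split => ?; mlin
  end.

Section Packing.
Variable k : fieldType.
Implicit Types U V W : lmodType k.

Definition mklin U V (f : U -> V) (lf : linear f) : {linear U -> V} :=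
  HB.pack f (GRing.isLinear.Build k U V *:%R f lf).

Definition mkbil U V W (f : U -> V -> W) (bf : bilinear f) :
    {bilinear U -> V -> W} :=
  HB.pack f (bilinear_isBilinear.Build k U V W *:%R *:%R f bf).

Lemma mklinE U V (f : U -> V) (lf : linear f) x : mklin lf x = f x.
Proof. by []. Qed.
Lemma mkbilE U V W (f : U -> V -> W) (bf : bilinear f) x y :
  mkbil bf x y = f x y.
Proof. by []. Qed.

(* A linear bijection, bundled with its (unique) inverse. *)
Record lin_auto (V : lmodType k) := LinAuto {
  laut :> {linear V -> V};
  linv : {linear V -> V};
  lautK : cancel laut linv;
  linvK : cancel linv laut
}.

Lemma tmap_linear U V U' V' (f : {linear U -> U'}) (g : {linear V -> V'}) :
  linear (fun t : U ⊗ V => \sw_(u, v <- t) (f u ⊗ g v)).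
Proof. by mlin. Qed.

Definition tmap U V U' V' (f : {linear U -> U'}) (g : {linear V -> V'}) :
  {linear (U ⊗ V)%type -> (U' ⊗ V')%type} := mklin (tmap_linear f g).

Lemma tmapE U V U' V' (f : {linear U -> U'}) (g : {linear V -> V'}) u v :
  tmap f g (u ⊗ v) = f u ⊗ g v.
Proof. by rewrite mklinE sw_pure //; mlin. Qed.

Lemma tmapK U V (f f' : {linear U -> U}) (g g' : {linear V -> V}) :
  cancel f f' -> cancel g g' -> cancel (tmap f g) (tmap f' g').
Proof.
by move=> fK gK; apply: tensor_ext => [||u v]; [mlin|mlin|rewrite !tmapE fK gK].
Qed.

Definition tens_auto U V (f : lin_auto U) (g : lin_auto V) : lin_auto (U ⊗ V)%type :=
  LinAuto (tmapK (@lautK _ f) (@lautK _ g)) (tmapK (@linvK _ f) (@linvK _ g)).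

Definition id_auto V : lin_auto V :=
  @LinAuto V idfun idfun (fun=> erefl) (fun=> erefl).

End Packing.

Section HomStructures.
Variable k : fieldType.

Definition hom_algebra (A : lmodType k) (mul : {bilinear A -> A -> A}) (one : A)
    (α : lin_auto A) : Prop :=
  [/\ forall a b, α (mul a b) = mul (α a) (α b),
      α one = one,
      forall a b c, mul (α a) (mul b c) = mul (mul a b) (α c),
      forall a, mul a one = α a
    & forall a, mul one a = α a].

Definition hom_module (A : lmodType k) (mul : {bilinear A -> A -> A}) (one : A)
    (α : lin_auto A) (M : lmodType k) (act : {bilinear A -> M -> M})
    (μ : lin_auto M) : Prop :=
  [/\ forall a m, μ (act a m) = act (α a) (μ m),
      forall a b m, act (α a) (act b m) = act (mul a b) (μ m)
    & forall m, act one m = μ m].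

Definition hom_coalgebra (C : lmodType k) (Δ : {linear C -> (C ⊗ C)%type})
    (ε : {scalar C}) (β : lin_auto C) : Prop :=
  [/\ forall c, Δ (β c) = \sw_(c1, c2 <- Δ c) (β c1 ⊗ β c2),
      forall c, ε (β c) = ε c,
      forall c,
        \sw_(c1, c2 <- Δ c) \sw_(c21, c22 <- Δ c2) (β c1 ⊗ (c21 ⊗ c22)) =
        \sw_(c1, c2 <- Δ c) \sw_(c11, c12 <- Δ c1) (c11 ⊗ (c12 ⊗ β c2)),
      forall c, \sw_(c1, c2 <- Δ c) (ε c1 *: c2) = β c
    & forall c, \sw_(c1, c2 <- Δ c) (ε c2 *: c1) = β c].

Definition hom_comodule (C : lmodType k) (Δ : {linear C -> (C ⊗ C)%type})
    (ε : {scalar C}) (β : lin_auto C) (M : lmodType k)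
    (ρ : {linear M -> (C ⊗ M)%type}) (μ : lin_auto M) : Prop :=
  [/\ forall m, ρ (μ m) = \sw_(c, m0 <- ρ m) (β c ⊗ μ m0),
      forall m, \sw_(c, m0 <- ρ m) (ε c *: m0) = μ m
    & forall m,
        \sw_(c, m0 <- ρ m) \sw_(d, m00 <- ρ m0) (β c ⊗ (d ⊗ m00)) =
        \sw_(c, m0 <- ρ m) \sw_(c1, c2 <- Δ c) (c1 ⊗ (c2 ⊗ μ m0))].

(* The componentwise product of the tensor square of an algebra. *)
Definition tensor_mul (A : lmodType k) (mul : {bilinear A -> A -> A})
    (s t : A ⊗ A) : A ⊗ A :=
  \sw_(a, b <- s) \sw_(c, d <- t) (mul a c ⊗ mul b d).

Definition tensor_flip (U V : lmodType k) (t : U ⊗ V) : V ⊗ U :=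
  \sw_(u, v <- t) (v ⊗ u).

(* The structure map is the same for the algebra and the coalgebra. *)
Record hom_hopf := HomHopf {
  hopf_sort :> lmodType k;
  hmul : {bilinear hopf_sort -> hopf_sort -> hopf_sort};
  hone : hopf_sort;
  hcomul : {linear hopf_sort -> (hopf_sort ⊗ hopf_sort)%type};
  hcounit : {scalar hopf_sort};
  haut : lin_auto hopf_sort;
  hopf_algebra : hom_algebra hmul hone haut;
  hopf_coalgebra : hom_coalgebra hcomul hcounit haut;
  hcomulM : forall h g, hcomul (hmul h g) = tensor_mul hmul (hcomul h) (hcomul g);
  hcomul1 : hcomul hone = hone ⊗ hone;
  hcounitM : forall h g, hcounit (hmul h g) = hcounit h * hcounit g;
  hcounit1 : hcounit hone = 1;
  hantipode : exists S : {linear hopf_sort -> hopf_sort},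
    [/\ forall h, \sw_(h1, h2 <- hcomul h) hmul (S h1) h2 = hcounit h *: hone,
        forall h, \sw_(h1, h2 <- hcomul h) hmul h1 (S h2) = hcounit h *: hone
      & forall h, S (haut h) = haut (S h)]
}.

End HomStructures.

Arguments hmul {k h} : rename.
Arguments hone {k h} : rename.
Arguments hcomul {k h} : rename.
Arguments hcounit {k h} : rename.
Arguments haut {k h} : rename.

Section QuasitriangularStructures.
Variable k : fieldType.

Record qt_hopf := QTHopf {
  qt_hopf_hopf :> hom_hopf k;
  Rmat : qt_hopf_hopf ⊗ qt_hopf_hopf;
  Rmat_counitl : \sw_(R1, R2 <- Rmat) (hcounit R1 *: R2) = hone;
  Rmat_counitr : \sw_(R1, R2 <- Rmat) (hcounit R2 *: R1) = hone;
  Rmat_comull :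
    \sw_(R1, R2 <- Rmat) (hcomul R1 ⊗ haut R2) =
    \sw_(R1, R2 <- Rmat) \sw_(r1, r2 <- Rmat)
      ((haut R1 ⊗ haut r1) ⊗ hmul R2 r2);
  Rmat_comulr :
    \sw_(R1, R2 <- Rmat) (haut R1 ⊗ hcomul R2) =
    \sw_(R1, R2 <- Rmat) \sw_(r1, r2 <- Rmat)
      (hmul R1 r1 ⊗ (haut r2 ⊗ haut R2));
  Rmat_comul : forall h,
    tensor_mul hmul (tensor_flip (hcomul h)) Rmat =
    tensor_mul hmul Rmat (hcomul h);
  Rmat_aut : \sw_(R1, R2 <- Rmat) (haut R1 ⊗ haut R2) = Rmat
}.

(* The inverse of R, in the componentwise product of H ⊗ H, is its flip. *)
Definition triangular (H : qt_hopf) : Prop :=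
  tensor_mul hmul (Rmat H) (tensor_flip (Rmat H)) = hone ⊗ hone /\
  tensor_mul hmul (tensor_flip (Rmat H)) (Rmat H) = hone ⊗ hone.

Record cqt_hopf := CQTHopf {
  cqt_hopf_hopf :> hom_hopf k;
  hform : {biscalar cqt_hopf_hopf};
  hform_mull : forall h g l,
    hform (hmul h g) (haut l) =
    \sw_(l1, l2 <- hcomul l) (hform (haut h) l2 * hform (haut g) l1 : k^o);
  hform_mulr : forall h g l,
    hform (haut h) (hmul g l) =
    \sw_(h1, h2 <- hcomul h) (hform h1 (haut g) * hform h2 (haut l) : k^o);
  hform_comul : forall h g,
    \sw_(h1, h2 <- hcomul h) \sw_(g1, g2 <- hcomul g)
      (hform h1 g1 *: hmul g2 h2) =
    \sw_(h1, h2 <- hcomul h) \sw_(g1, g2 <- hcomul g)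
      (hform h2 g2 *: hmul h1 g1);
  hform1l : forall h, hform hone h = hcounit h;
  hform1r : forall h, hform h hone = hcounit h;
  hform_aut : forall h g, hform (haut h) (haut g) = hform h g
}.

Definition cotriangular (B : cqt_hopf) : Prop :=
  forall h g : B,
    \sw_(h1, h2 <- hcomul h) \sw_(g1, g2 <- hcomul g)
      (hform B h1 g1 * hform B g2 h2 : k^o) = hcounit h * hcounit g.

End QuasitriangularStructures.

Section LongDimodules.
Variables (k : fieldType) (H B : hom_hopf k).

Record long_dimodule := LongDimodule {
  dim_sort :> lmodType k;
  dact : {bilinear H -> dim_sort -> dim_sort};
  dcoact : {linear dim_sort -> (B ⊗ dim_sort)%type};
  daut : lin_auto dim_sort;
  dim_module : hom_module hmul hone haut dact daut;
  dim_comodule : hom_comodule hcomul hcounit haut dcoact daut;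
  dim_compat : forall h m,
    dcoact (dact h m) = \sw_(b, m0 <- dcoact m) (haut b ⊗ dact (haut h) m0)
}.

Record long_morphism (M N : long_dimodule) := LongMorphism {
  long_map :> {linear M -> N};
  long_mapH : forall h m, long_map (dact M h m) = dact N h (long_map m);
  long_mapB : forall m,
    dcoact N (long_map m) = \sw_(b, m0 <- dcoact M m) (b ⊗ long_map m0);
  long_map_aut : forall m, long_map (daut M m) = daut N (long_map m)
}.

End LongDimodules.


Section SweedlerCalculus.
Variable k : fieldType.

Definition trilinear (U V V' W : lmodType k) (F : U -> V -> V' -> W) : Prop :=
  [/\ forall v v', linear (fun u => F u v v'),
      forall u v', linear (fun v => F u v v')
    & forall u v, linear (fun v' => F u v v')].

Lemma sw_sw (U V U' V' W : lmodType k) (s : U ⊗ V) (g : U -> V -> U' ⊗ V')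
    (F : U' -> V' -> W) : bilinear F ->
  sweedler (sweedler s g) F = \sw_(a, b <- s) sweedler (g a b) F.
Proof. by move=> bF; rewrite (linear_sw _ _ (sw_linear bF)). Qed.

Lemma ptensor_swr (U V V' X : lmodType k) (x : X) (t : U ⊗ V) (f : U -> V -> V') :
  x ⊗ sweedler t f = \sw_(a, b <- t) (x ⊗ f a b).
Proof. by rewrite (linear_sw _ _ (g := fun y => x ⊗ y)) //; mlin. Qed.

Lemma ptensor_swl (U V V' X : lmodType k) (x : X) (t : U ⊗ V) (f : U -> V -> V') :
  sweedler t f ⊗ x = \sw_(a, b <- t) (f a b ⊗ x).
Proof. by rewrite (linear_sw _ _ (g := fun y => y ⊗ x)) //; mlin. Qed.

Lemma scale_sw (U V V' : lmodType k) (c : k) (t : U ⊗ V) (f : U -> V -> V') :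
  c *: sweedler t f = \sw_(a, b <- t) (c *: f a b).
Proof. exact: scaler_sumr. Qed.

Lemma sw_tri (U V V' W : lmodType k) (F : U -> V -> V' -> W) :
  trilinear F -> bilinear (fun a (t : V ⊗ V') => \sw_(b, c <- t) F a b c).
Proof.
case=> F1 F2 F3; split=> [t|a]; first by apply: lin_swb => b c; apply: F1.
by apply: lin_swt; [apply: lin_id | split=> ?; [apply: F2|apply: F3]].
Qed.

Lemma tensor_ext3 (U V W X : lmodType k) (f g : (U ⊗ V) ⊗ W -> X) : linear f -> linear g ->
  (forall u v w, f (u ⊗ v ⊗ w) = g (u ⊗ v ⊗ w)) -> f =1 g.
Proof.
move=> lf lg e; apply: tensor_ext => // t w.
pose p (t : U ⊗ V) : (U ⊗ V) ⊗ W := ptensor t w; have lp : linear p by rewrite /p; mlin.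
apply: (tensor_ext (f := fun t => f (p t)) (g := fun t => g (p t))) => [a x y|a x y|u' v'].
- by rewrite lp lf.
- by rewrite lp lg.
- exact: e.
Qed.

Lemma tensor_ext3r (U V W X : lmodType k) (f g : U ⊗ (V ⊗ W) -> X) : linear f -> linear g ->
  (forall u v w, f (u ⊗ (v ⊗ w)) = g (u ⊗ (v ⊗ w))) -> f =1 g.
Proof.
move=> lf lg e; apply: tensor_ext => // u t.
pose p (t : V ⊗ W) : U ⊗ (V ⊗ W) := ptensor u t; have lp : linear p by rewrite /p; mlin.
apply: (tensor_ext (f := fun t => f (p t)) (g := fun t => g (p t))) => [a x y|a x y|u' v'].
- by rewrite lp lf.
- by rewrite lp lg.
- exact: e.
Qed.

Lemma tensor_ext4 (U V W X Y : lmodType k) (f g : ((U ⊗ V) ⊗ W) ⊗ X -> Y) :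
  linear f -> linear g ->
  (forall u v w x, f (u ⊗ v ⊗ w ⊗ x) = g (u ⊗ v ⊗ w ⊗ x)) -> f =1 g.
Proof.
move=> lf lg e; apply: tensor_ext => // t x.
pose p (t : (U ⊗ V) ⊗ W) : ((U ⊗ V) ⊗ W) ⊗ X := ptensor t x.
have lp : linear p by rewrite /p; mlin.
apply: (tensor_ext3 (f := fun t => f (p t)) (g := fun t => g (p t)))
  => [a y z|a y z|u' v' w'].
- by rewrite lp lf.
- by rewrite lp lg.
- exact: e.
Qed.

Section Hopf.
Variable A : hom_hopf k.
Implicit Types W : lmodType k.

Lemma hmul_aut (a b : A) : haut (hmul a b) = hmul (haut a) (haut b).
Proof. by case: (hopf_algebra A). Qed.
Lemma hone_aut : haut (hone : A) = hone.
Proof. by case: (hopf_algebra A). Qed.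
Lemma hmulA (a b c : A) : hmul (haut a) (hmul b c) = hmul (hmul a b) (haut c).
Proof. by case: (hopf_algebra A). Qed.
Lemma hmulr1 (a : A) : hmul a hone = haut a.
Proof. by case: (hopf_algebra A). Qed.
Lemma hmul1r (a : A) : hmul hone a = haut a.
Proof. by case: (hopf_algebra A). Qed.
Lemma hcounit_aut (a : A) : hcounit (haut a) = hcounit a.
Proof. by case: (hopf_coalgebra A). Qed.

Lemma hone_inv : linv haut (hone : A) = hone.
Proof. by rewrite -{1}hone_aut lautK. Qed.
Lemma hmul_inv (a b : A) : linv haut (hmul a b) = hmul (linv haut a) (linv haut b).
Proof. by rewrite -{1}[a](linvK haut) -{1}[b](linvK haut) -hmul_aut lautK. Qed.
Lemma hcounit_inv (a : A) : hcounit (linv haut a) = hcounit a.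
Proof. by rewrite -hcounit_aut linvK. Qed.

Lemma sw_comul_aut W (F : A -> A -> W) (c : A) : bilinear F ->
  \sw_(a, b <- hcomul (haut c)) F a b =
  \sw_(a, b <- hcomul c) F (haut a) (haut b).
Proof.
have [-> _ _ _ _] := hopf_coalgebra A; move=> bF.
by rewrite sw_sw //; apply: eq_sw => a b; rewrite sw_pure.
Qed.

Lemma bilinear_comp W (F : A -> A -> W) (f : {linear A -> A}) :
  bilinear F -> bilinear (fun a b => F (f a) (f b)).
Proof.
by case=> F1 F2; split=> [b|a] c x y; rewrite linearP ?F1 ?F2.
Qed.

Lemma sw_comul_inv W (F : A -> A -> W) (c : A) : bilinear F ->
  \sw_(a, b <- hcomul (linv haut c)) F a b =
  \sw_(a, b <- hcomul c) F (linv haut a) (linv haut b).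
Proof.
move=> bF; rewrite -{2}[c](linvK haut) sw_comul_aut ?lautK.
  by apply: eq_sw => a b; rewrite !lautK.
exact: (bilinear_comp (linv haut)).
Qed.

Lemma sw_comulM W (F : A -> A -> W) (c d : A) : bilinear F ->
  \sw_(a, b <- hcomul (hmul c d)) F a b =
  \sw_(c1, c2 <- hcomul c) \sw_(d1, d2 <- hcomul d) F (hmul c1 d1) (hmul c2 d2).
Proof.
move=> bF; rewrite hcomulM /tensor_mul sw_sw //; apply: eq_sw => c1 c2.
by rewrite sw_sw //; apply: eq_sw => d1 d2; rewrite sw_pure.
Qed.

Lemma sw_comul1 W (F : A -> A -> W) : bilinear F ->
  \sw_(a, b <- hcomul (hone : A)) F a b = F hone hone.
Proof. by move=> bF; rewrite hcomul1 sw_pure. Qed.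

Lemma sw_coassoc W (F : A -> A -> A -> W) (c : A) : trilinear F ->
  \sw_(c1, c2 <- hcomul c) \sw_(c21, c22 <- hcomul c2) F (haut c1) c21 c22 =
  \sw_(c1, c2 <- hcomul c) \sw_(c11, c12 <- hcomul c1) F c11 c12 (haut c2).
Proof.
move=> tF; have bF := sw_tri tF; have [_ _ /(_ c) e _ _] := hopf_coalgebra A.
have {e} := congr1 (fun t => sweedler t (fun a t' => \sw_(b, c <- t') F a b c)) e.
have bF' a : bilinear (F a) by case: tF.
rewrite !sw_sw //.
under eq_sw => a b.
  rewrite sw_sw //; under eq_sw => a' b' do rewrite sw_pure // sw_pure //.
over.
move=> ->; apply: eq_sw => a b; rewrite sw_sw //.
by apply: eq_sw => a' b'; rewrite sw_pure // sw_pure.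
Qed.

Lemma sw_counitl W (F : A -> W) (c : A) : linear F ->
  \sw_(c1, c2 <- hcomul c) (hcounit c1 *: F c2) = F (haut c).
Proof.
move=> lF; have [_ _ _ <- _] := hopf_coalgebra A; rewrite linear_sw //.
by apply: eq_sw => a b; rewrite -(linearZ_LR (mklin lF)).
Qed.

Lemma sw_counitr W (F : A -> W) (c : A) : linear F ->
  \sw_(c1, c2 <- hcomul c) (hcounit c2 *: F c1) = F (haut c).
Proof.
move=> lF; have [_ _ _ _ <-] := hopf_coalgebra A; rewrite linear_sw //.
by apply: eq_sw => a b; rewrite -(linearZ_LR (mklin lF)).
Qed.

End Hopf.

Section Dimodule.
Variables (H B : hom_hopf k) (M : long_dimodule H B).
Implicit Types W : lmodType k.
Local Notation μ := (daut M).
Local Notation act := (dact M).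
Local Notation ρ := (dcoact M).

Lemma dact_aut h m : μ (act h m) = act (haut h) (μ m).
Proof. by case: (dim_module M). Qed.
Lemma dactA g h m : act (haut g) (act h m) = act (hmul g h) (μ m).
Proof. by case: (dim_module M). Qed.
Lemma dact1 m : act hone m = μ m.
Proof. by case: (dim_module M). Qed.
Lemma dact_inv h m : linv μ (act h m) = act (linv haut h) (linv μ m).
Proof. by rewrite -{1}[h](linvK haut) -{1}[m](linvK μ) -dact_aut lautK. Qed.

Lemma sw_coact_aut W (F : B -> M -> W) m : bilinear F ->
  \sw_(b, m0 <- ρ (μ m)) F b m0 = \sw_(b, m0 <- ρ m) F (haut b) (μ m0).
Proof.
have [-> _ _] := dim_comodule M; move=> bF.
by rewrite sw_sw //; apply: eq_sw => a b; rewrite sw_pure.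
Qed.

Lemma sw_coact_inv W (F : B -> M -> W) m : bilinear F ->
  \sw_(b, m0 <- ρ (linv μ m)) F b m0 =
  \sw_(b, m0 <- ρ m) F (linv haut b) (linv μ m0).
Proof.
move=> [F1 F2]; rewrite -{2}[m](linvK μ) sw_coact_aut ?lautK.
  by apply: eq_sw => a b; rewrite !lautK.
by split=> ? a x y; rewrite linearP ?F1 ?F2.
Qed.

Lemma sw_coact_act W (F : B -> M -> W) h m : bilinear F ->
  \sw_(b, m0 <- ρ (act h m)) F b m0 =
  \sw_(b, m0 <- ρ m) F (haut b) (act (haut h) m0).
Proof.
move=> bF; rewrite dim_compat sw_sw //.
by apply: eq_sw => a b; rewrite sw_pure.
Qed.

Lemma sw_coact_counit W (F : M -> W) m : linear F ->
  \sw_(b, m0 <- ρ m) (hcounit b *: F m0) = F (μ m).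
Proof.
move=> lF; have [_ <- _] := dim_comodule M; rewrite linear_sw //.
by apply: eq_sw => a b; rewrite -(linearZ_LR (mklin lF)).
Qed.

Lemma sw_coact_coassoc W (F : B -> B -> M -> W) m : trilinear F ->
  \sw_(b, m0 <- ρ m) \sw_(c, m00 <- ρ m0) F (haut b) c m00 =
  \sw_(b, m0 <- ρ m) \sw_(b1, b2 <- hcomul b) F b1 b2 (μ m0).
Proof.
move=> tF; have bF := sw_tri tF; have [_ _ /(_ m) e] := dim_comodule M.
have {e} := congr1 (fun t => sweedler t (fun a t' => \sw_(b, c <- t') F a b c)) e.
have bF' a : bilinear (F a) by case: tF.
rewrite !sw_sw //.
under eq_sw => a b.
  rewrite sw_sw //; under eq_sw => a' b' do rewrite sw_pure // sw_pure //.
over.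
move=> ->; apply: eq_sw => a b; rewrite sw_sw //.
by apply: eq_sw => a' b'; rewrite sw_pure // sw_pure.
Qed.

End Dimodule.

End SweedlerCalculus.


Section TensorDimodule.
Variables (k : fieldType) (H B : hom_hopf k).

Section Two.
Variables M N : long_dimodule H B.

Lemma tens_act_bilinear : bilinear (fun (h : H) (t : M ⊗ N) =>
  \sw_(h1, h2 <- hcomul h) \sw_(m, n <- t) (dact M h1 m ⊗ dact N h2 n)).
Proof. by mlin. Qed.

Definition tens_act : {bilinear H -> (M ⊗ N)%type -> (M ⊗ N)%type} :=
  mkbil tens_act_bilinear.

Lemma tens_coact_linear : linear (fun t : M ⊗ N =>
  \sw_(m, n <- t) \sw_(b, m0 <- dcoact M m) \sw_(c, n0 <- dcoact N n)
    (linv haut (linv haut (hmul b c)) ⊗ (m0 ⊗ n0))).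
Proof. by mlin. Qed.

Definition tens_coact : {linear (M ⊗ N)%type -> (B ⊗ (M ⊗ N))%type} :=
  mklin tens_coact_linear.

Lemma tens_actE h m n :
  tens_act h (m ⊗ n) = \sw_(h1, h2 <- hcomul h) (dact M h1 m ⊗ dact N h2 n).
Proof. by rewrite mkbilE; apply: eq_sw => h1 h2; rewrite sw_pure //; mlin. Qed.

Lemma tens_coactE m n :
  tens_coact (m ⊗ n) =
  \sw_(b, m0 <- dcoact M m) \sw_(c, n0 <- dcoact N n)
    (linv haut (linv haut (hmul b c)) ⊗ (m0 ⊗ n0)).
Proof. by rewrite mklinE sw_pure //; mlin. Qed.

Lemma tens_autE m n :
  tens_auto (daut M) (daut N) (m ⊗ n) = daut M m ⊗ daut N n.
Proof. exact: tmapE. Qed.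

Lemma tens_module :
  hom_module hmul hone haut tens_act (tens_auto (daut M) (daut N)).
Proof.
split.
- move=> h; apply: tensor_ext => [||m n]; [mlin|mlin|].
  rewrite tens_autE !tens_actE linear_sw; last by mlin.
  rewrite sw_comul_aut; last by mlin.
  by apply: eq_sw => h1 h2; rewrite tens_autE !dact_aut.
- move=> g h; apply: tensor_ext => [||m n]; [mlin|mlin|].
  rewrite tens_autE !tens_actE linear_sw; last by mlin.
  rewrite sw_comulM; last by mlin.
  under eq_sw => h1 h2.
    rewrite tens_actE sw_comul_aut; last by mlin.
    under eq_sw => g1 g2 do rewrite !dactA.
  over.
  exact: exchange_sw.
- apply: tensor_ext => [||m n]; [mlin|mlin|].
  by rewrite tens_autE tens_actE sw_comul1 ?dact1 //; mlin.
Qed.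

Lemma sw_tens_coact (W : lmodType k) (F : B -> M ⊗ N -> W) m n : bilinear F ->
  \sw_(b, t <- tens_coact (m ⊗ n)) F b t =
  \sw_(b, m0 <- dcoact M m) \sw_(c, n0 <- dcoact N n)
    F (linv haut (linv haut (hmul b c))) (m0 ⊗ n0).
Proof.
move=> bF; rewrite tens_coactE sw_sw //; apply: eq_sw => b m0.
by rewrite sw_sw //; apply: eq_sw => c n0; rewrite sw_pure.
Qed.

Lemma tens_comodule :
  hom_comodule hcomul hcounit haut tens_coact (tens_auto (daut M) (daut N)).
Proof.
split.
- apply: tensor_ext => [||m n]; [mlin|mlin|].
  rewrite tens_autE tens_coactE sw_tens_coact; last by mlin.
  rewrite sw_coact_aut; last by mlin.
  apply: eq_sw => b m0; rewrite sw_coact_aut; last by mlin.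
  apply: eq_sw => c n0.
  by rewrite tens_autE -hmul_aut lautK linvK.
- apply: tensor_ext => [||m n]; [mlin|mlin|].
  rewrite tens_autE sw_tens_coact; last by mlin.
  under eq_sw => b m0.
    under eq_sw => c n0 do rewrite !hcounit_inv hcounitM -scalerA.
    rewrite -scale_sw.
    rewrite (sw_coact_counit (F := fun n0 => m0 ⊗ n0)); last by mlin.
  over.
  by rewrite (sw_coact_counit (F := fun m0 => m0 ⊗ daut N n)); last by mlin.
- apply: tensor_ext => [||m n]; [mlin|mlin|].
  rewrite !sw_tens_coact; [|by mlin|by mlin].
  pose β' (b : B) := linv haut (linv haut b).
  pose F b b' (m0 : M) c c' (n0 : N) :=
    β' (hmul b c) ⊗ (β' (hmul b' c') ⊗ (m0 ⊗ n0)).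
  transitivity (\sw_(b, m0 <- dcoact M m) \sw_(b', m00 <- dcoact M m0)
      \sw_(c, n0 <- dcoact N n) \sw_(c', n00 <- dcoact N n0)
        F (haut b) b' m00 (haut c) c' n00).
    apply: eq_sw => b m0; rewrite [RHS]exchange_sw; apply: eq_sw => c n0.
    rewrite sw_tens_coact; last by mlin.
    by rewrite /F /β' -hmul_aut !lautK linvK.
  transitivity (\sw_(b, m0 <- dcoact M m) \sw_(b1, b2 <- hcomul b)
      \sw_(c, n0 <- dcoact N n) \sw_(c1, c2 <- hcomul c)
        F b1 b2 (daut M m0) c1 c2 (daut N n0)).
    rewrite (sw_coact_coassoc (F := fun b b' m0 =>
      \sw_(c, n0 <- dcoact N n) \sw_(c', n00 <- dcoact N n0)
        F b b' m0 (haut c) c' n00)); last by split=> ? ?; rewrite /F /β'; mlin.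
    do 2!apply: eq_sw => ? ?.
    by rewrite sw_coact_coassoc; last by split=> ? ?; rewrite /F /β'; mlin.
  apply: eq_sw => b m0; rewrite exchange_sw; apply: eq_sw => c n0.
  rewrite sw_comul_inv; last by mlin.
  rewrite sw_comul_inv; last by mlin.
  rewrite sw_comulM; last by mlin.
  by apply: eq_sw => ? ?; apply: eq_sw => ? ?; rewrite /F tens_autE.
Qed.

Lemma tens_compat (h : H) (t : M ⊗ N) :
  tens_coact (tens_act h t) =
  \sw_(b, t0 <- tens_coact t) (haut b ⊗ tens_act (haut h) t0).
Proof.
move: t; apply: tensor_ext => [||m n]; [mlin|mlin|].
rewrite sw_tens_coact; last by mlin.
rewrite tens_actE linear_sw; last by mlin.
under eq_sw => h1 h2.
  rewrite tens_coactE sw_coact_act; last by mlin.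
  under eq_sw => b m0 do [rewrite sw_coact_act; last by mlin].
over.
rewrite [LHS]exchange_sw; apply: eq_sw => b m0.
rewrite [LHS]exchange_sw; apply: eq_sw => c n0.
rewrite tens_actE ptensor_swr.
rewrite sw_comul_aut; last by mlin.
by apply: eq_sw => h1 h2; rewrite -hmul_aut lautK linvK.
Qed.

Definition tens_dimodule : long_dimodule H B :=
  LongDimodule tens_module tens_comodule tens_compat.

Lemma tens_dactE h m n :
  dact tens_dimodule h (m ⊗ n) =
  \sw_(h1, h2 <- hcomul h) (dact M h1 m ⊗ dact N h2 n).
Proof. exact: tens_actE. Qed.

Lemma sw_tens_dcoact (W : lmodType k) (F : B -> tens_dimodule -> W) m n : bilinear F ->
  \sw_(b, t <- dcoact tens_dimodule (m ⊗ n)) F b t =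
  \sw_(b, m0 <- dcoact M m) \sw_(c, n0 <- dcoact N n)
    F (linv haut (linv haut (hmul b c))) (m0 ⊗ n0).
Proof. exact: sw_tens_coact. Qed.

Lemma tens_dcoactE m n :
  dcoact tens_dimodule (m ⊗ n) =
  \sw_(b, m0 <- dcoact M m) \sw_(c, n0 <- dcoact N n)
    (linv haut (linv haut (hmul b c)) ⊗ (m0 ⊗ n0)).
Proof. exact: tens_coactE. Qed.

Lemma tens_dautE m n : daut tens_dimodule (m ⊗ n) = daut M m ⊗ daut N n.
Proof. exact: tmapE. Qed.

Lemma tens_dinvE m n :
  linv (daut tens_dimodule) (m ⊗ n) = linv (daut M) m ⊗ linv (daut N) n.
Proof. exact: tmapE. Qed.

End Two.
End TensorDimodule.


Section Categories.

Record category := Category {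
  ob :> Type;
  hom : ob -> ob -> Type;
  idm : forall X, hom X X;
  compm : forall X Y Z, hom Y Z -> hom X Y -> hom X Z;
  compmA : forall W X Y Z (h : hom Y Z) (g : hom X Y) (f : hom W X),
    compm h (compm g f) = compm (compm h g) f;
  comp1m : forall X Y (f : hom X Y), compm (idm Y) f = f;
  compm1 : forall X Y (f : hom X Y), compm f (idm X) = f
}.

Record iso (C : category) (X Y : C) := Iso {
  iso_hom :> hom X Y;
  iso_inv : hom Y X;
  iso_homK : compm iso_inv iso_hom = idm X;
  iso_invK : compm iso_hom iso_inv = idm Y
}.

End Categories.

Notation "g ∘ f" := (compm g f) (at level 40, left associativity) : ring_scope.

Record monoidal_category := MonoidalCategory {
  mon_cat :> category;
  mtens : mon_cat -> mon_cat -> mon_cat;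
  mmap : forall X X' Y Y' : mon_cat,
    hom X X' -> hom Y Y' -> hom (mtens X Y) (mtens X' Y');
  munit : mon_cat;
  massoc : forall X Y Z, iso (mtens (mtens X Y) Z) (mtens X (mtens Y Z));
  mlunit : forall X, iso (mtens munit X) X;
  mrunit : forall X, iso (mtens X munit) X;
  mmap1 : forall X Y, mmap (idm X) (idm Y) = idm (mtens X Y);
  mmap_comp : forall X X' X'' Y Y' Y'' (f' : hom X' X'') (f : hom X X')
      (g' : hom Y' Y'') (g : hom Y Y'),
    mmap (f' ∘ f) (g' ∘ g) = mmap f' g' ∘ mmap f g;
  massoc_natural : forall X X' Y Y' Z Z' (f : hom X X') (g : hom Y Y')
      (h : hom Z Z'),
    mmap f (mmap g h) ∘ massoc X Y Z = massoc X' Y' Z' ∘ mmap (mmap f g) h;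
  mlunit_natural : forall X X' (f : hom X X'),
    f ∘ mlunit X = mlunit X' ∘ mmap (idm munit) f;
  mrunit_natural : forall X X' (f : hom X X'),
    f ∘ mrunit X = mrunit X' ∘ mmap f (idm munit);
  mpentagon : forall W X Y Z,
    massoc W X (mtens Y Z) ∘ massoc (mtens W X) Y Z =
    mmap (idm W) (massoc X Y Z) ∘ massoc W (mtens X Y) Z ∘ mmap (massoc W X Y) (idm Z);
  mtriangle : forall X Y,
    mmap (idm X) (mlunit Y) ∘ massoc X munit Y = mmap (mrunit X) (idm Y)
}.

Section Braidings.
Variable C : monoidal_category.
Implicit Types X Y Z : C.

Definition is_braiding (c : forall X Y, hom (mtens X Y) (mtens Y X)) : Prop :=
  [/\ forall X Y, exists d : hom (mtens Y X) (mtens X Y),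
        d ∘ c X Y = idm (mtens X Y) /\ c X Y ∘ d = idm (mtens Y X),
      forall X X' Y Y' (f : hom X X') (g : hom Y Y'),
        mmap g f ∘ c X Y = c X' Y' ∘ mmap f g,
      forall X Y Z,
        massoc Y Z X ∘ c X (mtens Y Z) ∘ massoc X Y Z =
        mmap (idm Y) (c X Z) ∘ massoc Y X Z ∘ mmap (c X Y) (idm Z)
    & forall X Y Z,
        iso_inv (massoc Z X Y) ∘ c (mtens X Y) Z ∘ iso_inv (massoc X Y Z) =
        mmap (c X Z) (idm Y) ∘ iso_inv (massoc X Z Y) ∘ mmap (idm X) (c Y Z)].

(* A symmetry is in particular a braiding: a natural isomorphism satisfying    *)
(* both hexagon identities.                                                    *)
Definition is_symmetry (c : forall X Y, hom (mtens X Y) (mtens Y X)) : Prop :=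
  is_braiding c /\ forall X Y, c Y X ∘ c X Y = idm (mtens X Y).

End Braidings.

Section LongCategory.
Variables (k : fieldType) (H B : hom_hopf k).
Local Notation dimod := (long_dimodule H B).
Implicit Types M N P Q : dimod.

Lemma linear_eq (U V : lmodType k) (f g : {linear U -> V}) : f =1 g -> f = g.
Proof.
move=> e; have {e} : (f : U -> V) = g by apply: funext.
case: f g => f [[af] [sf]] [g [[ag] [sg]]] /= e.
by move: af sf ag sg; rewrite {}e => *; congr (GRing.Linear.Pack (GRing.Linear.Class _ _));
  congr (_ _); exact: Prop_irrelevance.
Qed.

Lemma long_morphism_eq M N (f g : long_morphism M N) : f =1 g -> f = g.
Proof.
case: f g => f fH fB fa [g gH gB ga] /= /linear_eq e.
by move: fH fB fa; rewrite e => *; congr LongMorphism; exact: Prop_irrelevance.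
Qed.

Lemma sw_coact_morph (W : lmodType k) M N (f : long_morphism M N)
    (F : B -> N -> W) m : bilinear F ->
  \sw_(b, n <- dcoact N (f m)) F b n = \sw_(b, m0 <- dcoact M m) F b (f m0).
Proof.
move=> bF; rewrite long_mapB sw_sw //; apply: eq_sw => b m0.
by rewrite sw_pure.
Qed.

Lemma long_map_inv M N (f : long_morphism M N) m :
  f (linv (daut M) m) = linv (daut N) (f m).
Proof. by rewrite -{2}[m](linvK (daut M)) long_map_aut lautK. Qed.

Definition long_id M : long_morphism M M.
Proof.
exists (idfun : {linear M -> M}) => //= m; exact: tensor_reprE.
Defined.

Definition long_comp M N P (g : long_morphism N P) (f : long_morphism M N) :
  long_morphism M P.
Proof.
exists (mklin (f := fun m => g (f m)) (lin_comp g (@linearP _ _ _ _ f))).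
- by move=> h m; rewrite mklinE !long_mapH.
- move=> m; rewrite mklinE long_mapB sw_coact_morph //; mlin.
- by move=> m; rewrite mklinE !long_map_aut.
Defined.

Lemma long_compE M N P (g : long_morphism N P) (f : long_morphism M N) m :
  long_comp g f m = g (f m).
Proof. by []. Qed.

Definition long_category : category.
Proof.
by exists dimod (@long_morphism k H B) long_id long_comp => *; apply: long_morphism_eq.
Defined.

Local Notation ground := (GRing.Lmodule.clone k k^o _).

Lemma unit_act_bilinear : bilinear (fun (h : H) (a : k^o) => (hcounit h * a : k^o)).
Proof. by mlin. Qed.

Lemma unit_coact_linear : linear (fun a : k^o => (hone : B) ⊗ a).
Proof. by mlin. Qed.

Definition unit_act : {bilinear H -> k^o -> k^o} := mkbil unit_act_bilinear.
Definition unit_coact : {linear k^o -> (B ⊗ ground)%type} := mklin unit_coact_linear.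

Definition unit_dimodule : dimod.
Proof.
exists ground unit_act unit_coact (id_auto ground).
- split=> [h a|g h a|a] /=; rewrite /unit_act /=.
  + by rewrite hcounit_aut.
  + by rewrite hcounit_aut hcounitM mulrA.
  + by rewrite hcounit1 mul1r.
- have uE a : unit_coact a = hone ⊗ a by [].
  split=> a; rewrite !uE sw_pure; try mlin.
  + by rewrite hone_aut.
  + by rewrite hcounit1 scale1r.
  + rewrite sw_pure; last by mlin.
    by rewrite sw_pure ?sw_comul1 ?hone_aut //; mlin.
- by move=> h a; rewrite mklinE sw_pure ?hone_aut ?mkbilE ?hcounit_aut //; mlin.
Defined.

Definition long_tens_map M M' N N' (f : long_morphism M M') (g : long_morphism N N') :
  long_morphism (tens_dimodule M N) (tens_dimodule M' N').
Proof.
exists (tmap f g).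
- move=> h; apply: tensor_ext => [||m n]; [mlin|mlin|].
  rewrite tmapE !tens_dactE linear_sw; last by mlin.
  by apply: eq_sw => h1 h2; rewrite tmapE !long_mapH.
- apply: tensor_ext => [||m n]; [mlin|mlin|].
  rewrite tmapE tens_dcoactE sw_tens_dcoact; last by mlin.
  rewrite sw_coact_morph; last by mlin.
  apply: eq_sw => b m0; rewrite sw_coact_morph; last by mlin.
  by apply: eq_sw => c n0; rewrite tmapE.
- apply: tensor_ext => [||m n]; [mlin|mlin|].
  by rewrite !(tmapE, tens_dautE) !long_map_aut.
Defined.

Lemma long_tens_mapE M M' N N' (f : long_morphism M M') (g : long_morphism N N') m n :
  long_tens_map f g (m ⊗ n) = f m ⊗ g n.
Proof. exact: tmapE. Qed.

Lemma inverse_linear (U V : lmodType k) (f : {linear U -> V}) (g : V -> U) :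
  cancel f g -> cancel g f -> linear g.
Proof. by move=> fK gK a x y; apply: (can_inj fK); rewrite linearP !gK. Qed.

Section LongIso.
Variables (M N : dimod) (f : long_morphism M N) (g : {linear N -> M}).
Hypotheses (fK : cancel f g) (gK : cancel g f).

Definition long_inv : long_morphism N M.
Proof.
exists g.
- by move=> h n; apply: (can_inj fK); rewrite long_mapH !gK.
- move=> n; rewrite -{2}[n]gK sw_coact_morph; last by mlin.
  by rewrite {1}[dcoact _ _]tensor_reprE; apply: eq_sw => b m; rewrite fK.
- by move=> n; apply: (can_inj fK); rewrite long_map_aut !gK.
Defined.

Definition long_iso : @iso long_category M N.
Proof. by exists f long_inv; apply: long_morphism_eq. Defined.

End LongIso.

Section Associator.
Variables U V W : dimod.

Lemma assoc_linear : linear (fun t : (U ⊗ V) ⊗ W =>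
  \sw_(uv, w <- t) \sw_(u, v <- uv) (linv (daut U) u ⊗ (v ⊗ daut W w))).
Proof. by mlin. Qed.

Lemma assoc_inv_linear : linear (fun t : U ⊗ (V ⊗ W) =>
  \sw_(u, vw <- t) \sw_(v, w <- vw) ((daut U u ⊗ v) ⊗ linv (daut W) w)).
Proof. by mlin. Qed.

Lemma assocE u v w :
  mklin assoc_linear ((u ⊗ v) ⊗ w) = linv (daut U) u ⊗ (v ⊗ daut W w).
Proof. by rewrite mklinE sw_pure ?sw_pure //; mlin. Qed.

Lemma assoc_invE u v w :
  mklin assoc_inv_linear (u ⊗ (v ⊗ w)) = (daut U u ⊗ v) ⊗ linv (daut W) w.
Proof. by rewrite mklinE sw_pure ?sw_pure //; mlin. Qed.

Lemma assocK : cancel (mklin assoc_linear) (mklin assoc_inv_linear).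
Proof.
by apply: tensor_ext3 => [||u v w]; [mlin|mlin|rewrite assocE assoc_invE linvK lautK].
Qed.

Lemma assoc_invK : cancel (mklin assoc_inv_linear) (mklin assoc_linear).
Proof.
by apply: tensor_ext3r => [||u v w]; [mlin|mlin|rewrite assoc_invE assocE linvK lautK].
Qed.

Definition long_assoc_morphism : long_morphism
  (tens_dimodule (tens_dimodule U V) W) (tens_dimodule U (tens_dimodule V W)).
Proof.
exists (mklin assoc_linear).
- move=> h; apply: tensor_ext3 => [||u v w]; [mlin|mlin|].
  rewrite assocE !tens_dactE linear_sw; last by mlin.
  under eq_sw => h1 h2.
    rewrite tens_dactE ptensor_swl linear_sw; last by mlin.
    under eq_sw => h11 h12 do rewrite assocE dact_inv dact_aut.
  over.
  rewrite -(sw_coassoc (F := fun a b c => dact U (linv haut a) (linv (daut U) u) ⊗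
     (dact V b v ⊗ dact W c (daut W w)))); last by split=> ? ?; mlin.
  apply: eq_sw => h1 h2; rewrite lautK tens_dactE ptensor_swr.
  by [].
- apply: tensor_ext3 => [||u v w]; [mlin|mlin|].
  rewrite assocE tens_dcoactE sw_tens_dcoact; last by mlin.
  rewrite sw_coact_inv; last by mlin.
  rewrite sw_tens_dcoact; last by mlin.
  apply: eq_sw => a u0.
  rewrite sw_tens_dcoact; last by mlin.
  apply: eq_sw => b v0.
  rewrite sw_coact_aut; last by mlin.
  apply: eq_sw => c w0.


  rewrite assocE; congr (_ ⊗ _); rewrite !hmul_inv lautK.
  by have := hmulA (linv haut (linv haut (linv haut (linv haut a))))
    (linv haut (linv haut (linv haut (linv haut b))))
    (linv haut (linv haut (linv haut c))); rewrite !linvK.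
- apply: tensor_ext3 => [||u v w]; [mlin|mlin|].
  by rewrite tens_dautE tens_dautE !assocE !tens_dautE linvK lautK.
Defined.

Definition long_assoc : @iso long_category
  (tens_dimodule (tens_dimodule U V) W) (tens_dimodule U (tens_dimodule V W)) :=
  long_iso (f := long_assoc_morphism) assocK assoc_invK.

End Associator.

Section Unitors.
Variable V : dimod.

Lemma lunit_linear : linear (fun t : ground ⊗ V => \sw_(a, v <- t) (a : k) *: linv (daut V) v).
Proof. by mlin. Qed.
Lemma runit_linear : linear (fun t : V ⊗ ground => \sw_(v, a <- t) (a : k) *: linv (daut V) v).
Proof. by mlin. Qed.
Lemma lunit_inv_linear : linear (fun v : V => (1 : ground) ⊗ daut V v).
Proof. by mlin. Qed.
Lemma runit_inv_linear : linear (fun v : V => daut V v ⊗ (1 : ground)).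
Proof. by mlin. Qed.

Lemma lunitE a v : mklin lunit_linear (a ⊗ v) = a *: linv (daut V) v.
Proof. by rewrite mklinE sw_pure //; mlin. Qed.
Lemma runitE v a : mklin runit_linear (v ⊗ a) = a *: linv (daut V) v.
Proof. by rewrite mklinE sw_pure //; mlin. Qed.

Lemma lunitK : cancel (mklin lunit_linear) (mklin lunit_inv_linear).
Proof.
apply: tensor_ext => [||a v]; [mlin|mlin|rewrite lunitE mklinE].
by rewrite linearZ linvK linearZr -linearZl /= /GRing.scale /= mulr1.
Qed.
Lemma lunit_invK : cancel (mklin lunit_inv_linear) (mklin lunit_linear).
Proof. by move=> v; apply: etrans (lunitE _ _) _; rewrite scale1r lautK. Qed.

Lemma runitK : cancel (mklin runit_linear) (mklin runit_inv_linear).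
Proof.
apply: tensor_ext => [||a v]; [mlin|mlin|rewrite runitE mklinE].
by rewrite linearZ linvK linearZl -linearZr /= /GRing.scale /= mulr1.
Qed.
Lemma runit_invK : cancel (mklin runit_inv_linear) (mklin runit_linear).
Proof. by move=> v; apply: etrans (runitE _ _) _; rewrite scale1r lautK. Qed.

Definition lunit_morphism : long_morphism (tens_dimodule unit_dimodule V) V.
Proof.
exists (mklin lunit_linear).
- move=> h; apply: tensor_ext => [||a v]; [mlin|mlin|].
  rewrite tens_dactE linear_sw; last by mlin.
  under eq_sw => h1 h2.
    rewrite (_ : dact unit_dimodule h1 a = hcounit h1 * a :> k) // lunitE -scalerA.
  over.
  rewrite (sw_counitl (F := fun x => a *: linv (daut V) (dact V x v))); last by mlin.
  by rewrite dact_inv lautK lunitE linearZ.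
- apply: tensor_ext => [||a v]; [mlin|mlin|].
  rewrite lunitE linearZ_LR (sw_tens_dcoact (M := unit_dimodule) (N := V)); last by mlin.
  rewrite [dcoact V _]tensor_reprE sw_coact_inv; last exact: ptensor_bilinear.
  rewrite (_ : dcoact unit_dimodule a = hone ⊗ a) // sw_pure; last by mlin.
  rewrite scale_sw; apply: eq_sw => c v0.
  by rewrite lunitE hmul1r lautK linearZr.
- apply: tensor_ext => [||a v]; [mlin|mlin|].
  by rewrite tens_dautE !lunitE linearZ /= linvK lautK.
Defined.

Definition runit_morphism : long_morphism (tens_dimodule V unit_dimodule) V.
Proof.
exists (mklin runit_linear).
- move=> h; apply: tensor_ext => [||v a]; [mlin|mlin|].
  rewrite tens_dactE linear_sw; last by mlin.
  under eq_sw => h1 h2.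
    rewrite (_ : dact unit_dimodule h2 a = hcounit h2 * a :> k) // runitE -scalerA.
  over.
  rewrite (sw_counitr (F := fun x => a *: linv (daut V) (dact V x v))); last by mlin.
  by rewrite dact_inv lautK runitE linearZ.
- apply: tensor_ext => [||v a]; [mlin|mlin|].
  rewrite runitE linearZ_LR (sw_tens_dcoact (M := V) (N := unit_dimodule)); last by mlin.
  rewrite [dcoact V _]tensor_reprE sw_coact_inv; last exact: ptensor_bilinear.
  rewrite scale_sw; apply: eq_sw => c v0.
  rewrite (_ : dcoact unit_dimodule a = hone ⊗ a) // sw_pure; last by mlin.
  by rewrite runitE hmulr1 lautK linearZr.
- apply: tensor_ext => [||v a]; [mlin|mlin|].
  by rewrite tens_dautE !runitE linearZ /= linvK lautK.
Defined.

Definition long_lunit : @iso long_category (tens_dimodule unit_dimodule V) V :=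
  long_iso (f := lunit_morphism) lunitK lunit_invK.
Definition long_runit : @iso long_category (tens_dimodule V unit_dimodule) V :=
  long_iso (f := runit_morphism) runitK runit_invK.

End Unitors.

Lemma long_assocE U V W u v w :
  long_assoc_morphism U V W (u ⊗ v ⊗ w) = linv (daut U) u ⊗ (v ⊗ daut W w).
Proof. exact: assocE. Qed.
Lemma long_lunitE V a v : lunit_morphism V (a ⊗ v) = a *: linv (daut V) v.
Proof. exact: lunitE. Qed.
Lemma long_runitE V a v : runit_morphism V (v ⊗ a) = a *: linv (daut V) v.
Proof. exact: runitE. Qed.

Local Notation tmp := long_tens_map.

Lemma long_tens_map1 M N : tmp (long_id M) (long_id N) = long_id (tens_dimodule M N).
Proof.
apply: long_morphism_eq; apply: tensor_ext => [||m n]; [mlin|mlin|].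
by rewrite long_tens_mapE.
Qed.

Lemma long_tens_map_comp M M' M'' N N' N'' (f' : long_morphism M' M'')
    (f : long_morphism M M') (g' : long_morphism N' N'') (g : long_morphism N N') :
  tmp (long_comp f' f) (long_comp g' g) = long_comp (tmp f' g') (tmp f g).
Proof.
apply: long_morphism_eq; apply: tensor_ext => [||m n]; [mlin|mlin|].
by rewrite !(long_tens_mapE, long_compE).
Qed.

Lemma long_assoc_natural M M' N N' P P' (f : long_morphism M M')
    (g : long_morphism N N') (h : long_morphism P P') :
  long_comp (tmp f (tmp g h)) (long_assoc_morphism M N P) =
  long_comp (long_assoc_morphism M' N' P') (tmp (tmp f g) h).
Proof.
apply: long_morphism_eq; apply: tensor_ext3 => [||m n p]; [mlin|mlin|].
rewrite !(long_compE, long_tens_mapE, long_assocE).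
by rewrite long_map_inv long_map_aut.
Qed.

Lemma long_lunit_natural M N (f : long_morphism M N) :
  long_comp f (lunit_morphism M) =
  long_comp (lunit_morphism N) (tmp (long_id unit_dimodule) f).
Proof.
apply: long_morphism_eq; apply: tensor_ext => [||a m]; [mlin|mlin|].
rewrite !(long_compE, long_tens_mapE, long_lunitE).
by rewrite linearZ /= long_map_inv.
Qed.

Lemma long_runit_natural M N (f : long_morphism M N) :
  long_comp f (runit_morphism M) =
  long_comp (runit_morphism N) (tmp f (long_id unit_dimodule)).
Proof.
apply: long_morphism_eq; apply: tensor_ext => [||m a]; [mlin|mlin|].
rewrite !(long_compE, long_tens_mapE, long_runitE).
by rewrite linearZ /= long_map_inv.
Qed.

Lemma long_pentagon M N P Q :
  long_comp (long_assoc_morphism M N (tens_dimodule P Q))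
            (long_assoc_morphism (tens_dimodule M N) P Q) =
  long_comp (long_comp (tmp (long_id M) (long_assoc_morphism N P Q))
                       (long_assoc_morphism M (tens_dimodule N P) Q))
            (tmp (long_assoc_morphism M N P) (long_id Q)).
Proof.
apply: long_morphism_eq; apply: tensor_ext4 => [||m n p q]; [mlin|mlin|].
rewrite !(long_compE, long_tens_mapE, long_assocE, tens_dinvE, tens_dautE).
by [].
Qed.

Lemma long_triangle M N :
  long_comp (tmp (long_id M) (lunit_morphism N))
            (long_assoc_morphism M unit_dimodule N) =
  tmp (runit_morphism M) (long_id N).
Proof.
apply: long_morphism_eq; apply: tensor_ext3 => [||m a n]; [mlin|mlin|].
rewrite !(long_compE, long_tens_mapE, long_assocE).
by rewrite long_lunitE long_runitE lautK linearZr linearZl.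
Qed.

Definition long_monoidal : monoidal_category := @MonoidalCategory
  long_category (@tens_dimodule k H B) long_tens_map unit_dimodule
  long_assoc long_lunit long_runit
  long_tens_map1 long_tens_map_comp long_assoc_natural
  long_lunit_natural long_runit_natural long_pentagon long_triangle.

End LongCategory.


Section LongBraiding.
Variables (k : fieldType) (H : qt_hopf k) (B : cqt_hopf k).
Local Notation dimod := (long_dimodule H B).

Lemma sw_Rmat_aut (W : lmodType k) (F : H -> H -> W) : bilinear F ->
  \sw_(R1, R2 <- Rmat H) F (haut R1) (haut R2) = \sw_(R1, R2 <- Rmat H) F R1 R2.
Proof.
move=> bF; rewrite -{2}[Rmat H]Rmat_aut sw_sw //.
by apply: eq_sw => R1 R2; rewrite sw_pure.
Qed.

Lemma sw_Rmat_comul (W : lmodType k) (F : {bilinear H -> H -> W}) (h : H) :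
  \sw_(h1, h2 <- hcomul h) \sw_(R1, R2 <- Rmat H) F (hmul h2 R1) (hmul h1 R2) =
  \sw_(h1, h2 <- hcomul h) \sw_(R1, R2 <- Rmat H) F (hmul R1 h1) (hmul R2 h2).
Proof.
have bF : bilinear F by split=> u a x y; rewrite (linearPl, linearPr).
have := congr1 (fun t => sweedler t F) (Rmat_comul h).
rewrite /tensor_mul /tensor_flip sw_sw //= sw_sw; last by mlin.
under eq_sw => h1 h2.
  rewrite sw_pure; last by mlin.
  rewrite sw_sw //; under eq_sw => R1 R2 do rewrite sw_pure //.
over.
move=> ->; rewrite sw_sw // exchange_sw; apply: eq_sw => R1 R2.
by rewrite sw_sw //; apply: eq_sw => h1 h2; rewrite sw_pure.
Qed.

Lemma sw_form_comul (W : lmodType k) (F : {linear B -> W}) (b c : B) :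
  \sw_(b1, b2 <- hcomul b) \sw_(c1, c2 <- hcomul c) (hform B b1 c1 *: F (hmul c2 b2)) =
  \sw_(b1, b2 <- hcomul b) \sw_(c1, c2 <- hcomul c) (hform B b2 c2 *: F (hmul b1 c1)).
Proof.
have lF : linear F by exact: linearP.
have := congr1 F (hform_comul b c).
rewrite !linear_sw //; under eq_sw => b1 b2.
  rewrite linear_sw //; under eq_sw => c1 c2 do rewrite linearZ_LR.
over.
move=> ->; apply: eq_sw => b1 b2; rewrite linear_sw //; apply: eq_sw => c1 c2.
by rewrite linearZ_LR.
Qed.

Lemma hform_inv (b c : B) : hform B (linv haut b) (linv haut c) = hform B b c.
Proof. by rewrite -hform_aut !linvK. Qed.

Section Two.
Variables M N : dimod.

Definition braid_fun (t : M ⊗ N) : N ⊗ M :=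
  \sw_(m, n <- t) \sw_(b, m0 <- dcoact M m) \sw_(c, n0 <- dcoact N n)
    \sw_(R1, R2 <- Rmat H)
      (hform B b c *: (dact N R2 (linv (daut N) (linv (daut N) n0)) ⊗
                       dact M R1 (linv (daut M) (linv (daut M) m0)))).

Lemma braid_linear : linear braid_fun.
Proof. by rewrite /braid_fun; mlin. Qed.

Lemma braidE m n : mklin braid_linear (m ⊗ n) =
  \sw_(b, m0 <- dcoact M m) \sw_(c, n0 <- dcoact N n)
    \sw_(R1, R2 <- Rmat H)
      (hform B b c *: (dact N R2 (linv (daut N) (linv (daut N) n0)) ⊗
                       dact M R1 (linv (daut M) (linv (daut M) m0)))).
Proof. by rewrite mklinE /braid_fun sw_pure //; mlin. Qed.

Lemma dact_shift (P : dimod) (g h : H) (p : P) :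
  dact P g (dact P h (linv (daut P) (linv (daut P) p))) =
  dact P (hmul (linv haut g) h) (linv (daut P) p).
Proof. by rewrite -{1}[g](linvK haut) dactA linvK. Qed.

Lemma braidH (h : H) t :
  mklin braid_linear (dact (tens_dimodule M N) h t) =
  dact (tens_dimodule N M) h (mklin braid_linear t).
Proof.
move: t; apply: tensor_ext => [||m n]; [mlin|mlin|].
rewrite tens_dactE braidE linear_sw; last by mlin.
under eq_sw => h1 h2.
  rewrite braidE sw_coact_act; last by mlin.
  under eq_sw => b m0.
    rewrite sw_coact_act; last by mlin.
    under eq_sw => c n0.
      under eq_sw => R1 R2.
        rewrite hform_aut !dact_inv !lautK !dact_shift -!hmul_inv.
      over.
    over.
  over.
over.
rewrite [LHS]exchange_sw [RHS]linear_sw; last by mlin.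
apply: eq_sw => b m0.
rewrite [LHS]exchange_sw [RHS]linear_sw; last by mlin.
apply: eq_sw => c n0.
have bF : bilinear (fun x y => hform B b c *:
  (dact N (linv haut y) (linv (daut N) n0) ⊗
   dact M (linv haut x) (linv (daut M) m0))) by mlin.
rewrite -[LHS](sw_Rmat_comul (mkbil bF)).
rewrite [RHS]linear_sw; last by mlin.
rewrite [LHS]exchange_sw -[LHS]sw_Rmat_aut; last by mlin.
apply: eq_sw => R1 R2; rewrite [RHS]linearZr_LR.
rewrite tens_dactE scale_sw.
by apply: eq_sw => h1 h2; rewrite mkbilE !dact_shift !hmul_inv !lautK.
Qed.

Lemma braidB t :
  dcoact (tens_dimodule N M) (mklin braid_linear t) =
  \sw_(b, t0 <- dcoact (tens_dimodule M N) t) (b ⊗ mklin braid_linear t0).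
Proof.
move: t; apply: tensor_ext => [||m n]; [mlin|mlin|].
rewrite braidE sw_tens_dcoact; last by mlin.
pose G (m0 : M) (n0 : N) := \sw_(R1, R2 <- Rmat H)
  (dact N R2 (linv (daut N) (linv (daut N) n0)) ⊗
   dact M R1 (linv (daut M) (linv (daut M) m0))).
pose β' (b : B) := linv haut (linv haut (linv haut b)).
transitivity (\sw_(b, m0 <- dcoact M m) \sw_(c, n0 <- dcoact N n)
  \sw_(b1, b2 <- hcomul b) \sw_(c1, c2 <- hcomul c)
    (hform B b1 c1 *: (β' (hmul c2 b2) ⊗ G (daut M m0) (daut N n0)))).
  transitivity (\sw_(b, m0 <- dcoact M m) \sw_(b', m00 <- dcoact M m0)
     \sw_(c, n0 <- dcoact N n) \sw_(c', n00 <- dcoact N n0)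
       (hform B (haut b) (haut c) *: (β' (hmul c' b') ⊗ G m00 n00))).
    rewrite linear_sw; last by mlin.
    apply: eq_sw => b m0; rewrite linear_sw; last by mlin.
    rewrite [RHS]exchange_sw; apply: eq_sw => c n0.
    rewrite linear_sw; last by mlin.
    under eq_sw => R1 R2.
      rewrite linearZ_LR tens_dcoactE sw_coact_act; last by mlin.
      rewrite sw_coact_inv; last by mlin.
      rewrite sw_coact_inv; last by mlin.
      under eq_sw => c' n00.
        rewrite sw_coact_act; last by mlin.
        rewrite sw_coact_inv; last by mlin.
        rewrite sw_coact_inv; last by mlin.
        under eq_sw => b' m00 do rewrite !linvK -hmul_inv.
      over.
      rewrite exchange_sw scale_sw.
      under eq_sw => b' m00 do rewrite scale_sw.
    over.
    rewrite exchange_sw; apply: eq_sw => b' m00.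
    rewrite exchange_sw; apply: eq_sw => c' n00.
    rewrite hform_aut -scale_sw -ptensor_swr /G; congr (_ *: (_ ⊗ _)).
    by rewrite (sw_Rmat_aut (F := fun x y => dact N y _ ⊗ dact M x _)) //; mlin.
  rewrite (sw_coact_coassoc (F := fun b b' m0 =>
    \sw_(c, n0 <- dcoact N n) \sw_(c', n00 <- dcoact N n0)
       (hform B b (haut c) *: (β' (hmul c' b') ⊗ G m0 n00))));
    last by split=> ? ?; rewrite /G /β'; mlin.
  apply: eq_sw => b m0; rewrite [RHS]exchange_sw; apply: eq_sw => b1 b2.
  by rewrite (sw_coact_coassoc (F := fun c c' n0 =>
       (hform B b1 c *: (β' (hmul c' b2) ⊗ G (daut M m0) n0))));
    last by split=> ? ?; rewrite /G /β'; mlin.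
transitivity (\sw_(b, m0 <- dcoact M m) \sw_(c, n0 <- dcoact N n)
  \sw_(b1, b2 <- hcomul b) \sw_(c1, c2 <- hcomul c)
    (hform B b2 c2 *: (β' (hmul b1 c1) ⊗ G (daut M m0) (daut N n0)))).
  apply: eq_sw => b m0; apply: eq_sw => c n0.
  have lF : linear (fun x => β' x ⊗ G (daut M m0) (daut N n0)).
    by rewrite /G /β'; mlin.
  exact: (sw_form_comul (mklin lF)).
transitivity (\sw_(b, m0 <- dcoact M m) \sw_(b', m00 <- dcoact M m0)
     \sw_(c, n0 <- dcoact N n) \sw_(c', n00 <- dcoact N n0)
       (hform B b' c' *: (β' (hmul (haut b) (haut c)) ⊗ G m00 n00))).
  rewrite [RHS](sw_coact_coassoc (F := fun b b' m0 =>
    \sw_(c, n0 <- dcoact N n) \sw_(c', n00 <- dcoact N n0)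
       (hform B b' c' *: (β' (hmul b (haut c)) ⊗ G m0 n00))));
    last by split=> ? ?; rewrite /G /β'; mlin.
  apply: eq_sw => b m0; rewrite [LHS]exchange_sw; apply: eq_sw => b1 b2.
  by rewrite (sw_coact_coassoc (F := fun c c' n0 =>
       (hform B b2 c' *: (β' (hmul b1 c) ⊗ G (daut M m0) n0))));
    last by split=> ? ?; rewrite /G /β'; mlin.
apply: eq_sw => b m0; rewrite [LHS]exchange_sw; apply: eq_sw => c n0.
rewrite braidE ptensor_swr; apply: eq_sw => b' m00.
rewrite ptensor_swr; apply: eq_sw => c' n00.
by rewrite -scale_sw linearZr /β' -hmul_aut lautK.
Qed.

Lemma braid_aut t : mklin braid_linear (daut (tens_dimodule M N) t) =
  daut (tens_dimodule N M) (mklin braid_linear t).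
Proof.
move: t; apply: tensor_ext => [||m n]; [mlin|mlin|].
rewrite tens_dautE !braidE sw_coact_aut; last by mlin.
rewrite linear_sw; last by mlin.
apply: eq_sw => b m0; rewrite sw_coact_aut; last by mlin.
rewrite linear_sw; last by mlin.
apply: eq_sw => c n0; rewrite linear_sw; last by mlin.
rewrite -sw_Rmat_aut; last by mlin.
apply: eq_sw => R1 R2.
by rewrite linearZ_LR tens_dautE hform_aut !dact_aut !lautK !linvK.
Qed.

Definition long_braid : long_morphism (tens_dimodule M N) (tens_dimodule N M) :=
  @LongMorphism _ _ _ (tens_dimodule M N) (tens_dimodule N M) (mklin braid_linear) braidH braidB braid_aut.

End Two.

End LongBraiding.

(* Main.v *)
(** In a composite of two braidings the Hom-associativity of the actions gathers
    the R-matrices into one product acting on each factor, and the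
    Hom-coassociativity of the coactions gathers the scalars [<-|->] into
    coproducts in [B]. Hence the square of the braiding is governed by
    [R21 R = 1 ⊗ 1] and [<h1|g1><g2|h2> = ε(h) ε(g)], and each hexagon by one
    coproduct axiom of [R] together with one multiplicativity axiom of [<-|->].
    The powers of the structure maps match because [R] and [<-|->] are invariant
    under them. *)
Require Import Defs.
From mathcomp Require Import all_boot all_order all_algebra.

Set Implicit Arguments.
Unset Strict Implicit.
Unset Printing Implicit Defensive.

Import GRing.Theory.
Local Open Scope ring_scope.

Local Notation bilinear f := (bilinear_for *:%R *:%R f).

Section UniversalR.
Variables (k : fieldType) (H : qt_hopf k) (W : lmodType k).

Lemma sw_Rmat_comulr (F : H -> H -> H -> W) : trilinear F ->
  \sw_(R1, R2 <- Rmat H) \sw_(a, b <- hcomul R2) F (haut R1) a b =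
  \sw_(R1, R2 <- Rmat H) \sw_(r1, r2 <- Rmat H)
    F (hmul R1 r1) (haut r2) (haut R2).
Proof.
move=> tF; have bF := sw_tri tF; have bF' a : bilinear (F a) by case: tF.
have := congr1 (fun t => sweedler t (fun a t' => \sw_(b, c <- t') F a b c))
  (Rmat_comulr H).
rewrite !sw_sw //; under eq_sw => R1 R2 do rewrite sw_pure //.
move=> ->; apply: eq_sw => R1 R2; rewrite sw_sw //.
by apply: eq_sw => r1 r2; rewrite sw_pure // sw_pure.
Qed.

Lemma sw_Rmat_comull (F : H -> H -> H -> W) : trilinear F ->
  \sw_(R1, R2 <- Rmat H) \sw_(a, b <- hcomul R1) F a b (haut R2) =
  \sw_(R1, R2 <- Rmat H) \sw_(r1, r2 <- Rmat H)
    F (haut R1) (haut r1) (hmul R2 r2).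
Proof.
move=> [F1 F2 F3]; have bF' a : bilinear (fun b c => F b c a) by [].
have bF : bilinear (fun t a => \sw_(b, c <- t) F b c a).
  split=> [a|t]; last by apply: lin_swb => b c; apply: F3.
  exact: sw_linear.
have := congr1 (fun t => sweedler t (fun t' a => \sw_(b, c <- t') F b c a))
  (Rmat_comull H).
rewrite !sw_sw //; under eq_sw => R1 R2 do rewrite sw_pure //.
move=> ->; apply: eq_sw => R1 R2; rewrite sw_sw //.
by apply: eq_sw => r1 r2; rewrite sw_pure // sw_pure.
Qed.

Lemma sw_Rmat_flipM (F : {bilinear H -> H -> W}) : triangular H ->
  \sw_(R1, R2 <- Rmat H) \sw_(r1, r2 <- Rmat H) F (hmul r2 R1) (hmul r1 R2) =
  F hone hone.
Proof.
have bF : bilinear F by split=> u a x y; rewrite (linearPl, linearPr).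
move=> [_ /(congr1 (fun t => sweedler t F))].
rewrite sw_pure // => <-; rewrite /tensor_mul /tensor_flip sw_sw //.
rewrite sw_sw; last by mlin.
rewrite exchange_sw; apply: eq_sw => r1 r2; rewrite sw_pure; last by mlin.
by rewrite sw_sw //; apply: eq_sw => R1 R2; rewrite sw_pure.
Qed.

End UniversalR.

Lemma sw_form_cotriangular (k : fieldType) (B : cqt_hopf k) (W : lmodType k)
    (b c : B) (w : W) : cotriangular B ->
  \sw_(b1, b2 <- hcomul b) \sw_(c1, c2 <- hcomul c)
    ((hform B b1 c1 * hform B c2 b2) *: w) = (hcounit b * hcounit c) *: w.
Proof.
move=> <-; rewrite /sweedler scaler_suml.
by apply: eq_bigr => ? _; rewrite scaler_suml.
Qed.

Lemma scale_swl (k : fieldType) (U V W : lmodType k) (t : U ⊗ V)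
    (f : U -> V -> k^o) (w : W) :
  (sweedler t f : k) *: w = \sw_(a, b <- t) ((f a b : k) *: w).
Proof. exact: scaler_suml. Qed.

Section Braiding.
Variables (k : fieldType) (H : qt_hopf k) (B : cqt_hopf k).
Local Notation dimod := (long_dimodule H B).
Implicit Types X Y Z M N : dimod.

Lemma long_braidE M N (m : M) (n : N) : long_braid M N (m ⊗ n) =
  \sw_(b, m0 <- dcoact M m) \sw_(c, n0 <- dcoact N n)
    \sw_(R1, R2 <- Rmat H)
      (hform B b c *: (dact N R2 (linv (daut N) (linv (daut N) n0)) ⊗
                       dact M R1 (linv (daut M) (linv (daut M) m0)))).
Proof. exact: braidE. Qed.

Definition long_assoc_inv X Y Z : long_morphism
    (tens_dimodule X (tens_dimodule Y Z)) (tens_dimodule (tens_dimodule X Y) Z) :=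
  iso_inv (long_assoc X Y Z).

Lemma long_assoc_invE X Y Z (x : X) (y : Y) (z : Z) :
  long_assoc_inv X Y Z (x ⊗ (y ⊗ z)) = (daut X x ⊗ y) ⊗ linv (daut Z) z.
Proof. exact: assoc_invE. Qed.

Lemma long_braid_natural M M' N N' (f : long_morphism M M')
    (g : long_morphism N N') :
  long_comp (long_tens_map g f) (long_braid M N) =
  long_comp (long_braid M' N') (long_tens_map f g).
Proof.
apply: long_morphism_eq; apply: tensor_ext => [||m n]; [mlin|mlin|].
rewrite !long_compE long_tens_mapE !long_braidE linear_sw; last by mlin.
rewrite sw_coact_morph; last by mlin.
apply: eq_sw => b m0; rewrite linear_sw; last by mlin.
rewrite sw_coact_morph; last by mlin.
apply: eq_sw => c n0; rewrite linear_sw; last by mlin.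
apply: eq_sw => R1 R2.
by rewrite linearZ_LR long_tens_mapE !long_mapH !long_map_inv.
Qed.

Lemma long_braidK M N : triangular H -> cotriangular B ->
  long_comp (long_braid N M) (long_braid M N) = long_id (tens_dimodule M N).
Proof.
move=> tH tB; apply: long_morphism_eq; apply: tensor_ext => [||m n]; [mlin|mlin|].
rewrite long_compE long_braidE.
transitivity (\sw_(b, m0 <- dcoact M m) \sw_(b', m00 <- dcoact M m0)
  \sw_(c, n0 <- dcoact N n) \sw_(c', n00 <- dcoact N n0)
  ((hform B (haut b) (haut c) * hform B c' b') *:
    (linv (daut M) (linv (daut M) m00) ⊗ linv (daut N) (linv (daut N) n00)))).
  rewrite linear_sw; last by mlin.
  apply: eq_sw => b m0; rewrite linear_sw; last by mlin.
  rewrite [RHS]exchange_sw; apply: eq_sw => c n0.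
  rewrite linear_sw; last by mlin.
  under eq_sw => R1 R2.
    rewrite linearZ_LR long_braidE sw_coact_act; last by mlin.
    rewrite sw_coact_inv; last by mlin.
    rewrite sw_coact_inv; last by mlin.
    under eq_sw => c' n00.
      rewrite sw_coact_act; last by mlin.
      rewrite sw_coact_inv; last by mlin.
      rewrite sw_coact_inv; last by mlin.
      under eq_sw => b' m00.
        under eq_sw => r1 r2.
          rewrite !linvK hform_inv !dact_inv !dact_shift !lautK -!hmul_inv.
        over.
      over.
    over.
    rewrite exchange_sw scale_sw.
    under eq_sw => b' m00.
      rewrite scale_sw.
      under eq_sw => c' n00.
        rewrite scale_sw.
        under eq_sw => r1 r2 do rewrite scalerA.
      over.
    over.
  over.
  rewrite exchange_sw; apply: eq_sw => b' m00.
  rewrite exchange_sw; apply: eq_sw => c' n00.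
  have bF : bilinear (fun x y => (hform B b c * hform B c' b') *:
    (dact M (linv haut x) (linv (daut M) (linv (daut M) (linv (daut M) m00))) ⊗
     dact N (linv haut y) (linv (daut N) (linv (daut N) (linv (daut N) n00))))).
    by mlin.
  rewrite (sw_Rmat_flipM (mkbil bF) tH) mkbilE hform_aut.
  by rewrite !hone_inv !dact1 !linvK.
rewrite (sw_coact_coassoc (F := fun b b' m0 =>
  \sw_(c, n0 <- dcoact N n) \sw_(c', n00 <- dcoact N n0)
    ((hform B b (haut c) * hform B c' b') *:
     (linv (daut M) (linv (daut M) m0) ⊗ linv (daut N) (linv (daut N) n00)))));
  last by split=> ? ?; mlin.
under eq_sw => b m0.
  under eq_sw => b1 b2.
    rewrite (sw_coact_coassoc (F := fun c c' n0 =>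
      ((hform B b1 c * hform B c' b2) *:
       (linv (daut M) (linv (daut M) (daut M m0)) ⊗
        linv (daut N) (linv (daut N) n0))))); last by split=> ? ?; mlin.
    under eq_sw => c n0 do under eq_sw => c1 c2 do rewrite !lautK.
  over.
  rewrite exchange_sw.
  under eq_sw => c n0 do rewrite sw_form_cotriangular // -scalerA.
  rewrite -scale_sw (sw_coact_counit
    (F := fun n0 => linv (daut M) m0 ⊗ linv (daut N) n0)); last by mlin.
over.
rewrite (sw_coact_counit
  (F := fun m0 => linv (daut M) m0 ⊗ linv (daut N) (daut N n))); last by mlin.
by rewrite !lautK.
Qed.

Lemma long_hexagon X Y Z :
  long_comp (long_comp (long_assoc_morphism Y Z X)
                       (long_braid X (tens_dimodule Y Z)))
            (long_assoc_morphism X Y Z) =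
  long_comp (long_comp (long_tens_map (long_id Y) (long_braid X Z))
                       (long_assoc_morphism Y X Z))
            (long_tens_map (long_braid X Y) (long_id Z)).
Proof.
apply: long_morphism_eq; apply: tensor_ext3 => [||x y z]; [mlin|mlin|].
rewrite !long_compE long_tens_mapE long_assocE !long_braidE.
pose ξ' := linv (daut X); pose η' := linv (daut Y); pose ζ' := linv (daut Z).
pose G u0 y0 z0 := \sw_(R1, R2 <- Rmat H) \sw_(r1, r2 <- Rmat H)
  (dact Y r2 (η' (η' (η' y0))) ⊗
    (dact Z (haut R2) (ζ' z0) ⊗ dact X (hmul R1 r1) (ξ' u0))).
transitivity (\sw_(b, x0 <- dcoact X x)
  \sw_(c, y0 <- dcoact Y y) \sw_(d, z0 <- dcoact Z z)
  \sw_(b1, b2 <- hcomul b)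
  ((hform B b1 (haut c) * hform B b2 (haut (haut d))) *: G (ξ' x0) y0 z0)).
  rewrite linear_sw; last by mlin.
  rewrite sw_coact_inv; last by mlin.
  apply: eq_sw => b x0; rewrite linear_sw; last by mlin.
  rewrite sw_tens_dcoact; last by mlin.
  apply: eq_sw => c y0.
  rewrite sw_coact_aut; last by mlin.
  apply: eq_sw => d z0.
  rewrite linear_sw; last by mlin.
  under eq_sw => R1 R2.
    rewrite linearZ_LR !tens_dinvE tens_dactE ptensor_swl linear_sw; last by mlin.
    under eq_sw => a1 a2 do rewrite long_assocE dact_inv dact_aut lautK.
  over.
  rewrite -scale_sw.
  rewrite -[hform B _ _]hform_aut linvK -[hform B _ _]hform_aut !linvK.
  rewrite hform_mulr scale_swl; apply: eq_sw => b1 b2; congr (_ *: _).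
  rewrite (sw_Rmat_comulr (F := fun a b c => dact Y (linv haut b)
    (linv (daut Y) (linv (daut Y) (linv (daut Y) y0))) ⊗
    (dact Z c (linv (daut Z) z0) ⊗ dact X a (linv (daut X)
      (linv (daut X) x0))))); last by split=> ? ?; mlin.
  rewrite /G; apply: eq_sw => R1 R2; apply: eq_sw => r1 r2.
  by rewrite lautK.
rewrite (linear_sw _ _ (g := fun t => long_tens_map (long_id Y) (long_braid X Z)
  (long_assoc_morphism Y X Z (t ⊗ z)))); last by mlin.
transitivity (\sw_(b, x0 <- dcoact X x) \sw_(b', x00 <- dcoact X x0)
  \sw_(c, y0 <- dcoact Y y) \sw_(d, z0 <- dcoact Z z)
  ((hform B (haut b) (haut c) * hform B b' (haut (haut d))) *:
    G (ξ' (ξ' x00)) y0 z0)).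
  rewrite (sw_coact_coassoc (F := fun b b' x00 =>
    \sw_(c, y0 <- dcoact Y y) \sw_(d, z0 <- dcoact Z z)
    ((hform B b (haut c) * hform B b' (haut (haut d))) *:
    G (ξ' (ξ' x00)) y0 z0))); last by rewrite /G; split=> ? ?; mlin.
  apply: eq_sw => b x0.
  under eq_sw => c y0 do rewrite exchange_sw.
  rewrite exchange_sw; apply: eq_sw => b1 b2.
  by rewrite /ξ' lautK.
apply: eq_sw => b x0.
rewrite (linear_sw _ _ (g := fun t => long_tens_map (long_id Y) (long_braid X Z)
  (long_assoc_morphism Y X Z (t ⊗ z)))); last by mlin.
rewrite exchange_sw; apply: eq_sw => c y0.
rewrite (linear_sw _ _ (g := fun t => long_tens_map (long_id Y) (long_braid X Z)
  (long_assoc_morphism Y X Z (t ⊗ z)))); last by mlin.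
under [RHS]eq_sw => R1 R2.
  rewrite linearZl_LR !linearZ_LR long_assocE long_tens_mapE long_braidE.
  rewrite sw_coact_act; last by mlin.
  rewrite sw_coact_inv; last by mlin.
  rewrite sw_coact_inv; last by mlin.
  rewrite ptensor_swr scale_sw.
  under eq_sw => b' x00.
    rewrite sw_coact_aut; last by mlin.
    rewrite ptensor_swr scale_sw.
    under eq_sw => d z0.
      rewrite ptensor_swr scale_sw.
      under eq_sw => r1 r2.
        rewrite linearZr_LR scalerA !dact_inv !dact_shift !lautK.
      over.
    over.
  over.
over.
rewrite [RHS]exchange_sw; apply: eq_sw => b' x00.
rewrite [RHS]exchange_sw; apply: eq_sw => d z0.
rewrite [RHS]exchange_sw -[RHS]sw_Rmat_aut; last by mlin.
rewrite /G scale_sw; apply: eq_sw => R1 R2.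
rewrite -[RHS]sw_Rmat_aut; last by mlin.
rewrite scale_sw; apply: eq_sw => r1 r2.
by rewrite hform_aut linvK -[hform B b' _]hform_inv !lautK.
Qed.

Lemma long_hexagon_inv X Y Z :
  long_comp (long_comp (long_assoc_inv Z X Y)
                       (long_braid (tens_dimodule X Y) Z))
            (long_assoc_inv X Y Z) =
  long_comp (long_comp (long_tens_map (long_braid X Z) (long_id Y))
                       (long_assoc_inv X Z Y))
            (long_tens_map (long_id X) (long_braid Y Z)).
Proof.
apply: long_morphism_eq; apply: tensor_ext3r => [||x y z]; [mlin|mlin|].
rewrite !long_compE long_tens_mapE long_assoc_invE !long_braidE.
pose ξ' := linv (daut X); pose η' := linv (daut Y); pose ζ' := linv (daut Z).
pose G x0 y0 u0 := \sw_(R1, R2 <- Rmat H) \sw_(r1, r2 <- Rmat H)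
  (dact Z (hmul R2 r2) (ζ' (ζ' u0)) ⊗ dact X (haut R1) (ξ' x0) ⊗
    dact Y r1 (η' (η' (η' y0)))).
transitivity (\sw_(b, x0 <- dcoact X x)
  \sw_(c, y0 <- dcoact Y y) \sw_(d, z0 <- dcoact Z z)
  \sw_(d1, d2 <- hcomul d)
  ((hform B (haut (haut b)) d2 * hform B (haut c) d1) *: G x0 y0 z0)).
  rewrite linear_sw; last by mlin.
  rewrite sw_tens_dcoact; last by mlin.
  rewrite sw_coact_aut; last by mlin.
  apply: eq_sw => b x0; apply: eq_sw => c y0.
  rewrite linear_sw; last by mlin.
  rewrite sw_coact_inv; last by mlin.
  apply: eq_sw => d z0.
  rewrite linear_sw; last by mlin.
  under eq_sw => R1 R2.
    rewrite linearZ_LR !tens_dinvE tens_dactE ptensor_swr linear_sw; last by mlin.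
    under eq_sw => a1 a2 do rewrite long_assoc_invE dact_inv dact_aut !lautK linvK.
  over.
  rewrite -scale_sw.
  rewrite -[hform B _ _]hform_aut linvK -[hform B _ _]hform_aut !linvK.
  rewrite hform_mull scale_swl; apply: eq_sw => d1 d2; congr (_ *: _).
  rewrite (sw_Rmat_comull (F := fun a b c =>
    dact Z c (linv (daut Z) (linv (daut Z) z0)) ⊗ dact X a (linv (daut X) x0) ⊗
    dact Y (linv haut b) (linv (daut Y) (linv (daut Y) (linv (daut Y) y0)))));
    last by split=> ? ?; mlin.
  rewrite /G; apply: eq_sw => R1 R2; apply: eq_sw => r1 r2.
  by rewrite lautK.
rewrite (linear_sw _ _ (g := fun t => long_tens_map (long_braid X Z) (long_id Y)
  (long_assoc_inv X Z Y (long_id X x ⊗ t)))); last by mlin.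
rewrite exchange_sw; apply: eq_sw => c y0.
rewrite (linear_sw _ _ (g := fun t => long_tens_map (long_braid X Z) (long_id Y)
  (long_assoc_inv X Z Y (long_id X x ⊗ t)))); last by mlin.
transitivity (\sw_(d, z0 <- dcoact Z z) \sw_(d', z00 <- dcoact Z z0)
  \sw_(b, x0 <- dcoact X x)
  ((hform B (haut (haut b)) d' * hform B (haut c) (haut d)) *:
    G x0 y0 (ζ' z00))).
  rewrite (sw_coact_coassoc (F := fun d d' z00 => \sw_(b, x0 <- dcoact X x)
    ((hform B (haut (haut b)) d' * hform B (haut c) d) *:
      G x0 y0 (ζ' z00)))); last by rewrite /G; split=> ? ?; mlin.
  rewrite exchange_sw; apply: eq_sw => d z0.
  rewrite exchange_sw; apply: eq_sw => d1 d2.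
  by rewrite /ζ' lautK.
apply: eq_sw => d z0.
rewrite (linear_sw _ _ (g := fun t => long_tens_map (long_braid X Z) (long_id Y)
  (long_assoc_inv X Z Y (long_id X x ⊗ t)))); last by mlin.
under [RHS]eq_sw => R1 R2.
  rewrite linearZr_LR !linearZ_LR long_assoc_invE long_tens_mapE long_braidE.
  rewrite sw_coact_aut; last by mlin.
  rewrite ptensor_swl scale_sw.
  under eq_sw => b x0.
    rewrite sw_coact_act; last by mlin.
    rewrite sw_coact_inv; last by mlin.
    rewrite sw_coact_inv; last by mlin.
    rewrite ptensor_swl scale_sw.
    under eq_sw => d' z00.
      rewrite ptensor_swl scale_sw.
      under eq_sw => r1 r2.
        rewrite linearZl_LR scalerA !dact_inv !dact_shift !lautK.
      over.
    over.
  over.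
  rewrite exchange_sw.
over.
rewrite [RHS]exchange_sw; apply: eq_sw => d' z00.
rewrite [RHS]exchange_sw; apply: eq_sw => b x0.
rewrite [RHS]exchange_sw -[RHS]sw_Rmat_aut; last by mlin.
rewrite /G scale_sw; apply: eq_sw => R1 R2.
rewrite -[RHS]sw_Rmat_aut; last by mlin.
rewrite scale_sw; apply: eq_sw => r1 r2.
rewrite hform_aut linvK -[hform B (haut b) _]hform_aut linvK.
by rewrite !lautK mulrC.
Qed.

End Braiding.

Theorem theorem4p3 (k : fieldType) (H : qt_hopf k) (B : cqt_hopf k)
    (H_triangular : triangular H) (B_cotriangular : cotriangular B) :
  is_symmetry (C := long_monoidal H B) (@long_braid k H B).
Proof.
split; last by move=> X Y; apply: long_braidK.
split.
- by move=> X Y; exists (long_braid Y X); split; apply: long_braidK.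
- by move=> *; apply: long_braid_natural.
- by move=> *; apply: long_hexagon.
- by move=> *; apply: long_hexagon_inv.
Qed.
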